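(* Let $M$ be a hyperbolic 3-manifold with toroidal boundary, $\mathcal T$ an ideal triangulation of $M$ and $\mathbf z\in\mathcal V_{\mathcal T}$. Let $\boldsymbol\alpha=(\alpha_1,\dots,\alpha_k)$ and $\boldsymbol\alpha'=(\alpha_1',\dots,\alpha_k')$ be two systems of simple closed curves on $\partial M$. Assume that $\tau(M,\boldsymbol\alpha,\mathbf z,\mathcal T)$ is non-zero. Then $$\tau(M,\boldsymbol\alpha',\mathbf z,\mathcal T)=\pm\det\bigg(\frac{\partial\mathrm H(\alpha_i')}{\partial\mathrm H(\alpha_j)}\bigg)_{ij}\,\tau(M,\boldsymbol\alpha,\mathbf z,\mathcal T).$$
   Context: Gluing variety. Let $M$ be an oriented hyperbolic 3-manifold with toroidal boundary $T_1\sqcup\dots\sqcup T_k$; a system of simple closed curves $\boldsymbol\alpha=(\alpha_1,\dots,\alpha_k)$ consists of a non-trivial simple closed curve $\alpha_i\subset T_i$ for each $i$. Let $\mathcal T=\{\Delta_1,\dots,\Delta_n\}$ be an ideal triangulation with edges $e_1,\dots,e_n$ ordered so that the edge equations of $e_1,\dots,e_{n-k}$ are linearly independent and imply the other $k$. For each $\Delta_i$ choose a pair of opposite edges with shape parameter $z_i\in\mathbb C\setminus\{0,1\}$; the other pairs carry $z_i'=\frac1{1-z_i}$, $z_i''=1-\frac1{z_i}$ (in the cyclic order given by the orientation). Let $E_{j,i},E'_{j,i},E''_{j,i}$ be the numbers of edges of $\Delta_i$ with parameter $z_i,z_i',z_i''$ incident to $e_j$, and $C_{j,i},C'_{j,i},C''_{j,i}$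 the numbers of corners with parameter $z_i,z_i',z_i''$ in the cusp triangulation to the left of $\alpha_j$ minus those to the right. The gluing variety $\mathcal V_{\mathcal T}$ is the set of $\mathbf z=(z_1,\dots,z_n)$ with $\prod_iz_i^{E_{j,i}}(z_i')^{E'_{j,i}}(z_i'')^{E''_{j,i}}=1$ for $j\le n-k$. The logarithmic holonomy is (locally) $\mathrm H(\alpha_j)=\sum_i(C_{j,i}\log z_i+C'_{j,i}\log z_i'+C''_{j,i}\log z_i'')$, up to additive multiples of $2\pi\sqrt{-1}$. 1-loop invariant. Let $G,G',G''$ be the $n\times n$ integer matrices whose first $n-k$ rows are $(E_{j,i}),(E'_{j,i}),(E''_{j,i})$ and last $k$ rows are $(C_{j,i}),(C'_{j,i}),(C''_{j,i})$. A strong combinatorial flattening is $(\mathbf f,\mathbf f',\mathbf f'')\in(\mathbb Z^n)^3$ with $f_i+f_i'+f_i''=1$ for all $i$ such that for every system of simple closed curves the vector $G\mathbf f^T+G'\mathbf f'^T+G''\mathbf f''^T$ has first $n-k$ entries $2$ and last $k$ entries $0$ (these exist). Then $$\tau(M,\boldsymbol\alpha,\mathbf z,\mathcal T)=\pm\tfrac12\det\big((G-G')\Delta_{\mathbf z''}+(G''-G')\Delta_{\mathbf z}^{-1}\big)\prod_{i=1}^nz_i^{f_i''}(z_i'')^{-f_i},$$ where $\Delta_{\mathbf z}=\mathrm{diag}(z_1,\dots,z_n)$, $\Delta_{\mathbf z''}=\mathrm{diag}(z_1'',\dots,z_n'')$. Up to a non-zero factor independent of $\boldsymbol\alpha$,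 $\tau$ is the Jacobian determinant at $\mathbf z$ of the map whose components are the $n-k$ logarithmic edge sums and $\mathrm H(\alpha_1),\dots,\mathrm H(\alpha_k)$; when it is non-zero, $(\mathrm H(\alpha_1),\dots,\mathrm H(\alpha_k))$ are local holomorphic coordinates on $\mathcal V_{\mathcal T}$ near $\mathbf z$, and $\frac{\partial\mathrm H(\alpha_i')}{\partial\mathrm H(\alpha_j)}$ denotes the partial derivative of $\mathrm H(\alpha_i')$ on $\mathcal V_{\mathcal T}$ with respect to these coordinates, evaluated at $\mathbf z$. *)

(* Defs.v *)
From HB Require Import structures.
From Stdlib Require Import Relation_Operators.
From mathcomp Require Import all_boot all_order all_algebra all_fingroup.
From mathcomp Require Import all_classical all_reals all_analysis.
From mathcomp Require Import complex.

Set Implicit Arguments.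
Unset Strict Implicit.
Unset Printing Implicit Defensive.

Import Order.TTheory GRing.Theory Num.Theory.
Import numFieldNormedType.Exports.

Local Open Scope ring_scope.

(* Typed as a numFieldType: this is what provides the topology of the complex *)
(* numbers and makes differentiable mean complex differentiable.              *)
Definition Cplx (R : realType) : numFieldType := (R[i])%C : numFieldType.

(** * Oriented triangulations *)

(* n tetrahedra with vertices 0, 1, 2, 3; face f is the one opposite to       *)
(* vertex f. The face f of Delta_i is glued to the face gl i f f of           *)
(* Delta_(adj i f), each vertex a <> f being sent to gl i f a. Every          *)
(* tetrahedron carries the orientation of its vertex order, for which         *)
(* (0, oo, 1, w) with Im w > 0 is positive, so the gluings are compatible     *)
(* with the orientations exactly when all the gl i f are odd.                 *)
Record triangulation (n : nat) := Triangulation {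
  adj : 'I_n -> 'I_4 -> 'I_n;
  gl : 'I_n -> 'I_4 -> 'S_4;
  adjK : forall i f, adj (adj i f) (gl i f f) = i;
  glK : forall i f, gl (adj i f) (gl i f f) = (gl i f)^-1%g;
  gl_odd : forall i f, odd_perm (gl i f);
  gl_free : forall i f, (adj i f, gl i f f) != (i, f)
}.

(* A face of dimension d of a tetrahedron is given by its d+1 vertices.       *)
Definition cell_adj n (T : triangulation n) : rel ('I_n * {set 'I_4}) :=
  fun x y => [exists f, (f \notin x.2) &&
    (y == (adj T x.1 f, [set gl T x.1 f a | a in x.2]%SET))].

(* The link of the ideal vertices (the triangulated boundary) has one         *)
(* triangle (i, v) for each vertex v of Delta_i; its corners are labelled by  *)
(* the w <> v, the corner w lying on the edge vw of Delta_i. A face of that   *)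
(* triangle is given by its set of corners.                                   *)
Definition link_adj n (T : triangulation n) :
    rel ('I_n * 'I_4 * {set 'I_4}) :=
  fun x y => [exists f, (f != x.1.2) && (f \notin x.2) &&
    (y == (adj T x.1.1 f, gl T x.1.1 f x.1.2,
           [set gl T x.1.1 f a | a in x.2]%SET))].

Definition link_euler n k (T : triangulation n) (cusp : 'I_n -> 'I_4 -> 'I_k)
    (c : 'I_k) : int :=
  \sum_(d < 3) (-1) ^+ d *
    (n_comp (link_adj T) [pred x : 'I_n * 'I_4 * {set 'I_4} |
       [&& cusp x.1.1 x.1.2 == c, x.1.2 \notin x.2 & #|x.2| == d.+1]])%:Z.

(* m + k is the number of tetrahedra, and of edges; k is the number of        *)
(* boundary components. The latter are closed, connected and oriented, hence  *)
(* tori once their Euler characteristic is 0. The pair of opposite edges      *)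
(* chosen in Delta_i is the one of index quad i (see edge_pair).              *)
Record ideal_triangulation (m k : nat) := IdealTriangulation {
  tri :> triangulation (m + k);
  edge_of : 'I_(m + k) -> {set 'I_4} -> 'I_(m + k);
  cusp_of : 'I_(m + k) -> 'I_4 -> 'I_k;
  quad : 'I_(m + k) -> 'I_3;
  edge_ofP : forall i (e : {set 'I_4}) i' (e' : {set 'I_4}),
    #|e| = 2%N -> #|e'| = 2%N ->
    edge_of i e = edge_of i' e' <-> connect (cell_adj tri) (i, e) (i', e');
  edge_of_onto : forall j, exists i (e : {set 'I_4}), #|e| = 2%N /\ edge_of i e = j;
  cusp_ofP : forall i v i' v', cusp_of i v = cusp_of i' v' <->
    connect (cell_adj tri) (i, [set v]%SET) (i', [set v']%SET);
  cusp_of_onto : forall c, exists i v, cusp_of i v = c;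
  toroidal : forall c, link_euler tri cusp_of c = 0
}.

(** * Hyperbolic manifolds *)

Definition upper_half_space (R : realType) : set (R * R * R) :=
  [set p | 0 < p.2]%classic.

Definition sqnormc (R : realType) (w : R[i]) : R :=
  complex.Re w ^+ 2 + complex.Im w ^+ 2.

(* Poincare extension of the Moebius transformation of matrix g.              *)
Definition mobius (R : realType) (g : 'M[Cplx R]_2) (p : R * R * R) :
    R * R * R :=
  let a : R[i] := g 0 0 in let b : R[i] := g 0 1 in
  let c : R[i] := g 1 0 in let d : R[i] := g 1 1 in
  let w : R[i] := (p.1.1 +i* p.1.2)%C in let t := p.2 in
  let u := c * w + d in
  let N := sqnormc u + sqnormc c * t ^+ 2 in
  let q := (a * w + b) * conjc u + a * conjc c * (t ^+ 2)%:C%C in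
  (complex.Re q / N, complex.Im q / N, t / N).

(* Complete oriented hyperbolic 3-manifolds of finite volume, as quotients of *)
(* the upper half-space by the preimage in SL_2(C) of a discrete torsion-free *)
(* subgroup of PSL_2(C) having a fundamental set of finite volume.            *)
Record hyperbolic_manifold (R : realType) := HyperbolicManifold {
  hgroup : set 'M[Cplx R]_2;
  hgroup_det : forall g, hgroup g -> \det g = 1;
  hgroup1 : hgroup 1%:M;
  hgroupM : forall g h, hgroup g -> hgroup h -> hgroup (g *m h);
  hgroupV : forall g, hgroup g -> hgroup (invmx g);
  hgroup_discrete :
    (\forall g \near (1%:M : 'M[Cplx R]_2), hgroup g -> g = 1%:M)%classic;
  hgroup_torsion_free : forall g r, hgroup g -> (0 < r)%N ->
    g ^+ r = 1 \/ g ^+ r = -1 -> g = 1 \/ g = -1;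
  hgroup_finite_volume : exists F : set (measurableTypeR R *
      measurableTypeR R * measurableTypeR R),
    [/\ measurable F,
        (F `<=` @upper_half_space R)%classic,
        forall p, upper_half_space p -> exists2 g, hgroup g & F (mobius g p) &
        (\int[(lebesgue_measure \x lebesgue_measure) \x lebesgue_measure]_(p in F)
           ((p.2 : R) ^- 3)%:E < +oo)%E]
}.

Definition same_orbit R (M : hyperbolic_manifold R) (p q : R * R * R) : Prop :=
  exists2 g, hgroup M g & mobius g p = q.

(* A closed simplex, in barycentric coordinates, minus its vertices.          *)
Definition ideal_simplex (R : realType) : set 'rV[R]_4 :=
  [set x | (forall a, 0 <= x 0 a < 1) /\ \sum_a x 0 a = 1]%classic.

Definition face_glued (R : realType) n (T : triangulation n)
    (p q : 'I_n * 'rV[R]_4) : Prop :=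
  exists f, [/\ p.2 0 f = 0, q.1 = adj T p.1 f &
                forall a, q.2 0 (gl T p.1 f a) = p.2 0 a].

Definition same_point (R : realType) n (T : triangulation n) :
    'I_n * 'rV[R]_4 -> 'I_n * 'rV[R]_4 -> Prop :=
  clos_refl_sym_trans _ (@face_glued R n T).

(* T is an ideal triangulation of (the interior of) M: there is a             *)
(* homeomorphism from the space obtained by gluing the ideal simplices onto   *)
(* the quotient of the half-space. It is induced by phi, and the last clause  *)
(* says that the bijection identifies the two quotient topologies.            *)
Definition triangulates (R : realType) n (T : triangulation n)
    (M : hyperbolic_manifold R) : Prop :=
  exists phi : 'I_n -> 'rV[R]_4 -> R * R * R,
  [/\ forall i x, ideal_simplex x -> upper_half_space (phi i x),
      forall i x j y, ideal_simplex x -> ideal_simplex y ->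
        same_point T (i, x) (j, y) <-> same_orbit M (phi i x) (phi j y),
      forall p, upper_half_space p ->
        exists i x, ideal_simplex x /\ same_orbit M (phi i x) p &
      forall U : set (R * R * R),
        (U `<=` @upper_half_space R)%classic ->
        (forall p q, upper_half_space p -> same_orbit M p q -> U p -> U q) ->
        open U <-> forall i, exists O : set 'rV[R]_4, open O /\
          forall x, ideal_simplex x -> U (phi i x) <-> O x].

(** * Shape parameters and edges *)

(* Pairs of opposite edges, in the cyclic order given by the orientation: in  *)
(* the simplex (0, oo, 1, w) they have parameters w, 1/(1-w) and 1-1/w.       *)
Definition edge_pair (e : {set 'I_4}) : 'I_3 :=
  if (e == [set 0; 1]%SET) || (e == [set 2; 3]%SET) then 0
  else if (e == [set 1; 2]%SET) || (e == [set 0; 3]%SET) then 1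
  else 2.

(* 0, 1 or 2 according as the parameter of the edge e of Delta_i is z_i, z_i' *)
(* or z_i''; the subtraction is modulo 3.                                     *)
Definition edge_param m k (T : ideal_triangulation m k) (i : 'I_(m + k))
    (e : {set 'I_4}) : 'I_3 :=
  edge_pair e - quad T i.

Definition shape_param (R : realType) (q : 'I_3) (w : Cplx R) : Cplx R :=
  nth 0 [:: w; (1 - w)^-1; 1 - w^-1] q.

Definition edge_num m k (T : ideal_triangulation m k) (q : 'I_3)
    (j i : 'I_(m + k)) : nat :=
  #|[set e : {set 'I_4} | [&& #|e| == 2%N, edge_of T i e == j
                            & edge_param T i e == q]]%SET|.

Definition shapes (R : realType) n : set 'rV[Cplx R]_n :=
  [set z | forall i, z 0 i <> 0 /\ z 0 i <> 1]%classic.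

Definition edge_product (R : realType) m k (T : ideal_triangulation m k)
    (j : 'I_(m + k)) (z : 'rV[Cplx R]_(m + k)) : Cplx R :=
  \prod_i \prod_(q < 3) shape_param q (z 0 i) ^+ edge_num T q j i.

Definition gluing_variety (R : realType) m k (T : ideal_triangulation m k) :
    set 'rV[Cplx R]_(m + k) :=
  [set z | shapes z /\ forall j : 'I_m, edge_product T (lshift k j) z = 1]%classic.

(* In logarithmic form, since log z + log z' + log z'' is constant, the edge  *)
(* equation of e_j has coefficients E - E' and E'' - E' in log z and log z''. *)
Definition edges_ordered (R : realType) m k (T : ideal_triangulation m k) :
    Prop :=
  row_free (row_mx
    (\matrix_(j < m, i < m + k) ((edge_num T 0 (lshift k j) i)%:R
       - (edge_num T 1 (lshift k j) i)%:R : rat))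
    (\matrix_(j < m, i < m + k) ((edge_num T 2 (lshift k j) i)%:R
       - (edge_num T 1 (lshift k j) i)%:R : rat)))
  /\ forall z : 'rV[Cplx R]_(m + k), gluing_variety T z ->
       forall j, edge_product T j z = 1.

(** * Curves on the boundary *)

(* Points of the link triangle (i, v) are written in the barycentric          *)
(* coordinates of Delta_i, with v-coordinate 0.                               *)
Definition open_side (R : realType) (v f : 'I_4) (x : 'rV[R]_4) : Prop :=
  \sum_a x 0 a = 1 /\
  forall a, if (a == v) || (a == f) then x 0 a = 0 else 0 < x 0 a.

(* A straight segment in the triangle (i, s 0), from a point of the side      *)
(* opposite to the corner s 1 to a point of the side opposite to the corner   *)
(* s 2, hence cutting off the corner s 3.                                     *)
Record link_arc (R : realType) (n : nat) := LinkArc {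
  arc_tet : 'I_n;
  arc_flag : 'S_4;
  arc_in : 'rV[R]_4;
  arc_out : 'rV[R]_4
}.

Record closed_curve (R : realType) (n : nat) := ClosedCurve {
  curve_len : nat;
  curve_arc :> 'I_curve_len.+1 -> link_arc R n
}.

Definition arc_proper (R : realType) n (a : link_arc R n) : Prop :=
  open_side (arc_flag a 0) (arc_flag a 1) (arc_in a) /\
  open_side (arc_flag a 0) (arc_flag a 2) (arc_out a).

Definition arc_next (R : realType) n (T : triangulation n) (a b : link_arc R n) :
    Prop :=
  let f := arc_flag a 2 in let g := gl T (arc_tet a) f in
  [/\ arc_tet b = adj T (arc_tet a) f,
      arc_flag b 0 = g (arc_flag a 0),
      arc_flag b 1 = g f &
      forall x, arc_in b 0 (g x) = arc_out a 0 x].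

Definition arc_disjoint (R : realType) n (a b : link_arc R n) : Prop :=
  arc_tet a = arc_tet b -> arc_flag a 0 = arc_flag b 0 ->
  forall s t : R, 0 <= s <= 1 -> 0 <= t <= 1 ->
    (1 - s) *: arc_in a + s *: arc_out a <> (1 - t) *: arc_in b + t *: arc_out b.

Definition simple_closed (R : realType) n (T : triangulation n)
    (c : closed_curve R n) : Prop :=
  [/\ forall t, arc_proper (c t),
      forall t, arc_next T (c t) (c (ordS t)) &
      forall t t', t != t' -> arc_disjoint (c t) (c t')].

(* Edge paths in the dual graph of the link: (i, v, f) is the passage from    *)
(* the triangle (i, v) to its neighbour across the side opposite to f.        *)
Definition crossing n : Type := ('I_n * 'I_4 * 'I_4)%type.

Definition cross_inv n (T : triangulation n) (x : crossing n) : crossing n :=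
  let: (i, v, f) := x in (adj T i f, gl T i f v, gl T i f f).

Fixpoint dual_path n (T : triangulation n) (p : 'I_n * 'I_4)
    (s : seq (crossing n)) : bool :=
  if s is x :: s' then
    [&& x.1 == p, x.2 != x.1.2 & dual_path T (cross_inv T x).1 s']
  else true.

(* (i, s) crosses the triangle (i, s 0) as an arc of flag s does; turn        *)
(* carries on around the corner s 3 into the next triangle.                   *)
Definition turn n (T : triangulation n) (x : 'I_n * 'S_4) : 'I_n * 'S_4 :=
  let f := x.2 2 in (adj T x.1 f, (tperm 1%R 2%R * x.2 * gl T x.1 f)%g).

Definition vertex_loop n (T : triangulation n) (x : 'I_n * 'S_4) :
    seq (crossing n) :=
  [seq (y.1, y.2 0, y.2 2) | y : 'I_n * 'S_4 <- fingraph.orbit (turn T) x].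

Variant insertion n (T : triangulation n) :
    seq (crossing n) -> seq (crossing n) -> Prop :=
| InsertBacktrack u v x :
    insertion T (u ++ v) (u ++ [:: x; cross_inv T x] ++ v)
| InsertVertexLoop u v x :
    insertion T (u ++ v) (u ++ vertex_loop T x ++ v).

Definition null_homotopic n (T : triangulation n) (p : 'I_n * 'I_4)
    (s : seq (crossing n)) : Prop :=
  clos_refl_sym_trans _
    (fun s1 s2 => [/\ dual_path T p s1, dual_path T p s2 & insertion T s1 s2])
    s [::].

Definition curve_word (R : realType) n (c : closed_curve R n) :
    seq (crossing n) :=
  [seq (arc_tet (c t), arc_flag (c t) 0, arc_flag (c t) 2)
     | t <- enum 'I_(curve_len c).+1].

Definition nontrivial_curve (R : realType) n (T : triangulation n)
    (c : closed_curve R n) : Prop :=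
  ~ null_homotopic T (arc_tet (c ord0), arc_flag (c ord0) 0) (curve_word c).

Definition curve_system (R : realType) m k (T : ideal_triangulation m k)
    (al : 'I_k -> closed_curve R (m + k)) : Prop :=
  forall j, [/\ simple_closed T (al j), nontrivial_curve T (al j) &
    forall t, cusp_of T (arc_tet (al j t)) (arc_flag (al j t) 0) = j].

(* Seen from the cusp, the corners w1, w2, w3 of the triangle (i, v) are in   *)
(* counterclockwise order iff (v, w1, w2, w3) is an odd permutation, so the   *)
(* corner cut off by an arc lies to its left iff the flag of the arc is even. *)
Definition corner_num (R : realType) m k (T : ideal_triangulation m k)
    (al : 'I_k -> closed_curve R (m + k)) (q : 'I_3) (j : 'I_k)
    (i : 'I_(m + k)) : int :=
  \sum_(t | (arc_tet (al j t) == i) &&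
            (edge_param T i [set arc_flag (al j t) 0; arc_flag (al j t) 3]%SET
               == q))
    (-1) ^+ (arc_flag (al j t) : bool).

(** * The 1-loop invariant *)

(* G, G' and G'' are glue_mx T al 0, glue_mx T al 1 and glue_mx T al 2.       *)
Definition glue_mx (R : realType) m k (T : ideal_triangulation m k)
    (al : 'I_k -> closed_curve R (m + k)) (q : 'I_3) : 'M[int]_(m + k) :=
  col_mx (\matrix_(j < m, i < m + k) (edge_num T q (lshift k j) i)%:Z)
         (\matrix_(j < k, i < m + k) corner_num T al q j i).

Definition strong_flattening (R : realType) m k (T : ideal_triangulation m k)
    (f : 'I_3 -> 'rV[int]_(m + k)) : Prop :=
  (forall i, f 0 0 i + f 1 0 i + f 2 0 i = 1) /\
  forall al : 'I_k -> closed_curve R (m + k), curve_system T al ->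
    glue_mx T al 0 *m (f 0)^T + glue_mx T al 1 *m (f 1)^T
      + glue_mx T al 2 *m (f 2)^T
    = col_mx (const_mx 2) (const_mx 0).

Definition intr_mx (R : realType) p q (A : 'M[int]_(p, q)) :
    'M[Cplx R]_(p, q) :=
  map_mx (fun c : int => c%:~R) A.

(* The invariant is defined up to sign; this is the representative with sign +. *)
Definition tau (R : realType) m k (T : ideal_triangulation m k)
    (al : 'I_k -> closed_curve R (m + k)) (f : 'I_3 -> 'rV[int]_(m + k))
    (z : 'rV[Cplx R]_(m + k)) : Cplx R :=
  let G q := intr_mx R (glue_mx T al q) in
  2^-1 * \det ((G 0 - G 1) *m diag_mx (map_mx (@shape_param R 2) z)
               + (G 2 - G 1) *m invmx (diag_mx z))
  * \prod_i (z 0 i ^ f 2 0 i * shape_param 2 (z 0 i) ^ (- f 0 0 i)).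

Definition eq_up_to_sign (V : zmodType) (x y : V) : Prop := x = y \/ x = - y.

(** * Logarithmic holonomy and coordinates on the gluing variety *)

Local Open Scope classical_set_scope.

Definition cexp (R : realType) (w : Cplx R) : Cplx R :=
  let x := complex.Re (w : R[i]) in let y := complex.Im (w : R[i]) in
  ((expR x * cos y) +i* (expR x * sin y))%C.

Definition log_branch (R : realType) (a : Cplx R) (l : Cplx R -> Cplx R) :
    Prop :=
  \forall w \near a, cexp (l w) = w /\ {for w, continuous l}.

(* Local determinations of log z_i, log z_i' and log z_i'' near z.            *)
Definition log_branches (R : realType) n (z : 'rV[Cplx R]_n)
    (L : 'I_3 -> 'I_n -> Cplx R -> Cplx R) : Prop :=
  forall q i, log_branch (shape_param q (z 0 i)) (L q i).

(* The vector (H(al_1), ..., H(al_k)).                                        *)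
Definition log_holonomy (R : realType) m k (T : ideal_triangulation m k)
    (L : 'I_3 -> 'I_(m + k) -> Cplx R -> Cplx R)
    (al : 'I_k -> closed_curve R (m + k)) (w : 'rV[Cplx R]_(m + k)) :
    'rV[Cplx R]_k :=
  \row_j \sum_i \sum_(q < 3)
    (corner_num T al q j i)%:~R * L q i (shape_param q (w 0 i)).

(* zeta is a holomorphic inverse, near z, of H restricted to V.               *)
Definition coordinate_inverse (R : realType) n k (V : set 'rV[Cplx R]_n)
    (H : 'rV[Cplx R]_n -> 'rV[Cplx R]_k) (z : 'rV[Cplx R]_n)
    (zeta : 'rV[Cplx R]_k -> 'rV[Cplx R]_n) : Prop :=
  [/\ zeta (H z) = z,
      \forall h \near H z,
        [/\ differentiable zeta h, V (zeta h) & H (zeta h) = h] &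
      \forall w \near z, V w -> zeta (H w) = w].

(* Partial derivative at z, on V, of the function phi with respect to the     *)
(* j-th of the local holomorphic coordinates H; it does not depend on the     *)
(* choice of zeta, as all the local inverses have the same germ at H z.       *)
Definition coordinate_partial (R : realType) n k (V : set 'rV[Cplx R]_n)
    (H : 'rV[Cplx R]_n -> 'rV[Cplx R]_k) (z : 'rV[Cplx R]_n)
    (phi : 'rV[Cplx R]_n -> Cplx R) (j : 'I_k) : Cplx R :=
  'D_(delta_mx 0 j) (phi \o get (coordinate_inverse V H z)) (H z).

(* Main.v *)
Require Import Defs.
From mathcomp Require Import all_boot all_order all_algebra all_fingroup.
From mathcomp Require Import all_classical all_reals all_analysis.
From mathcomp Require Import complex.
From mathcomp Require Import ring lra.
Import Order.TTheory GRing.Theory Num.Theory.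
Import numFieldNormedType.Exports.
Local Open Scope ring_scope.

(** Let F_al be the map whose components are the logarithms of the first m
    edge products followed by the holonomies of al. Up to a factor which
    does not involve al, tau is the Jacobian determinant of F_al at z. If
    it does not vanish, F_al has a holomorphic local inverse by the inverse
    function theorem. Near z the gluing variety is a fibre of the edge
    components of F_al, because exp is locally injective; hence the last k
    components of F_al restrict to coordinates on it. The edge components
    of F_al and F_al' coincide, so J_al^-1 J_al' is block triangular with
    an identity block, and its other diagonal block is the transpose of the
    matrix of partial derivatives of the holonomies of al' (the Jacobians
    act on row vectors). In particular the formula holds with the sign +. *)

Set Implicit Arguments.
Unset Strict Implicit.
Unset Printing Implicit Defensive.

Local Open Scope classical_set_scope.

(** * Limits of matrices and strict differentiability *)

Lemma cvg_near (T : Type) (F : set_system T) (U : topologicalType) (f : T -> U)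
    (y : U) (P : set U) :
  f x @[x --> F] --> y -> nbhs y P -> \forall x \near F, P (f x).
Proof. by move=> fy; exact: fy. Qed.

Lemma near_forall (T : Type) (F : set_system T) {FF : Filter F} (I : finType)
    (P : I -> T -> Prop) :
  (forall i, \forall x \near F, P i x) -> \forall x \near F, forall i, P i x.
Proof. exact: filter_forall. Qed.

Lemma near_forall2 (T : Type) (F : set_system T) {FF : Filter F} (I J : finType)
    (P : I -> J -> T -> Prop) :
  (forall i j, \forall x \near F, P i j x) ->
  \forall x \near F, forall i j, P i j x.
Proof. by move=> FP; apply: near_forall => i; exact: near_forall (FP i). Qed.

Section MatrixTopology.
Variable K : numFieldType.

Lemma mx_norm_le m n (A : 'M[K]_(m, n)) c :
  0 <= c -> (forall i j, `|A i j| <= c) -> `|A| <= c.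
Proof.
move=> c0 Ac; have [|] := eqVneq (mx_norm A) 0.
  by rewrite /Num.norm /= => ->.
by move=> /mx_norm_neq0[[i j]] /= e; rewrite /Num.norm /= e.
Qed.

Lemma le_mx_norm m n (A : 'M[K]_(m, n)) i j : `|A i j| <= `|A|.
Proof.
rewrite [leRHS]/Num.norm /= mx_normE -[leLHS]nngE num_le.
by apply/bigmax_geP; right; exists (i, j).
Qed.

(** The norm is the maximum of the absolute values of the entries, and an entry of the product is a
    sum of [n] terms; hence the factor [n], which later constants must absorb. *)
Lemma mulmx_norm_le m n p (A : 'M[K]_(m, n)) (B : 'M[K]_(n, p)) :
  `|A *m B| <= n%:R * (`|A| * `|B|).
Proof.
apply: mx_norm_le => [|i j]; first by rewrite !mulr_ge0.
rewrite mxE (le_trans (ler_norm_sum _ _ _))//.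
have -> : n%:R * (`|A| * `|B|) = \sum_(k < n) `|A| * `|B|.
  by rewrite sumr_const card_ord mulr_natl.
by apply: ler_sum => k _; rewrite normrM ler_pM// le_mx_norm.
Qed.

Variables (T : Type) (F : set_system T).
Context {FF : Filter F}.

(** A neighbourhood of a matrix contains a product of neighbourhoods of its finitely many
    entries. *)
Lemma cvg_mx m n (M : T -> 'M[K]_(m, n)) (A : 'M[K]_(m, n)) :
  (forall i j, M x i j @[x --> F] --> A i j) -> M x @[x --> F] --> A.
Proof.
move=> MA B [P PA PB].
have : \forall x \near F, forall i j, P i j (M x i j).
  by apply: near_forall2 => i j; exact: MA (PA i j).
by apply: filterS => x Px; exact: PB.
Qed.

Lemma cvg_coord m n (M : T -> 'M[K]_(m, n)) (A : 'M[K]_(m, n)) i j :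
  M x @[x --> F] --> A -> M x i j @[x --> F] --> A i j.
Proof.
by move=> MA; exact: (cvg_comp _ _ MA (@coord_continuous K m n i j A)).
Qed.

Lemma cvg_sumr (I : Type) (r : seq I) (P : pred I) (V : normedModType K)
    (f : I -> T -> V) (a : I -> V) :
  (forall i, P i -> f i x @[x --> F] --> a i) ->
  \sum_(i <- r | P i) f i x @[x --> F] --> \sum_(i <- r | P i) a i.
Proof. by apply: cvg_big => //; exact: add_continuous. Qed.

Lemma cvg_prodr (I : Type) (r : seq I) (P : pred I)
    (f : I -> T -> K) (a : I -> K) :
  (forall i, P i -> f i x @[x --> F] --> a i) ->
  \prod_(i <- r | P i) f i x @[x --> F] --> \prod_(i <- r | P i) a i.
Proof. by apply: cvg_big => //; exact: mul_continuous. Qed.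

Lemma cvg_mulmx m n p (M : T -> 'M[K]_(m, n)) (N : T -> 'M[K]_(n, p))
    (A : 'M[K]_(m, n)) (B : 'M[K]_(n, p)) :
  M x @[x --> F] --> A -> N x @[x --> F] --> B ->
  M x *m N x @[x --> F] --> A *m B.
Proof.
move=> MA NB; apply: cvg_mx => i j; rewrite mxE.
under eq_cvg do rewrite mxE.
by apply: cvg_sumr => k _; apply: cvgM; exact: cvg_coord.
Qed.

Lemma cvg_det n (M : T -> 'M[K]_n) (A : 'M[K]_n) :
  M x @[x --> F] --> A -> \det (M x) @[x --> F] --> \det A.
Proof.
move=> MA; apply: cvg_sumr => s _; apply: cvgM; first exact: cvg_cst.
by apply: cvg_prodr => i _; exact: cvg_coord.
Qed.

Lemma cvg_unitmx n (M : T -> 'M[K]_n) (A : 'M[K]_n) :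
  M x @[x --> F] --> A -> A \in unitmx -> \forall x \near F, M x \in unitmx.
Proof.
move=> /cvg_det MA; rewrite unitmxE unitfE => A0.
have := @cvgr_neq0 _ _ _ _ FF _ _ MA A0; apply: filterS => x.
by rewrite unitmxE unitfE.
Qed.

Lemma cvg_invmx n (M : T -> 'M[K]_n) (A : 'M[K]_n) :
  M x @[x --> F] --> A -> A \in unitmx -> invmx (M x) @[x --> F] --> invmx A.
Proof.
move=> MA Au; have Mu := cvg_unitmx MA Au.
rewrite /invmx Au.
have : (\det (M x))^-1 *: \adj (M x) @[x --> F] --> (\det A)^-1 *: \adj A.
  apply: cvg_mx => i j; rewrite !mxE; under eq_cvg do rewrite !mxE.
  apply: cvgM; first by apply: cvgV; [rewrite -unitfE -unitmxE|exact: cvg_det].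
  apply: cvgM; first exact: cvg_cst.
  apply: cvg_det; apply: cvg_mx => k l; rewrite !mxE.
  by under eq_cvg do rewrite !mxE; exact: cvg_coord.
(* [invmx] is given by cofactors on invertible matrices, and [M x] is eventually invertible. *)
apply: cvg_trans; apply: near_eq_cvg.
by apply: filterS Mu => x ->.
Qed.

End MatrixTopology.

(* Strict differentiability in the style of Caratheodory: the slope is a      *)
(* function of two points, continuous on the diagonal.                        *)
Definition slope_at (K : numFieldType) n p (f : 'rV[K]_n -> 'rV[K]_p)
    (q : 'rV[K]_n * 'rV[K]_n -> 'M[K]_(n, p)) (z : 'rV[K]_n) :=
  (\forall xy \near (z, z), f xy.1 - f xy.2 = (xy.1 - xy.2) *m q xy) /\
  (\forall w \near z, {for (w, w), continuous q}).

Lemma cvg_prod_nbhs (T : Type) (F : set_system T) {FF : Filter F}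
    (U V : topologicalType) (f : T -> U) (g : T -> V) (a : U) (b : V) :
  f x @[x --> F] --> a -> g x @[x --> F] --> b ->
  (f x, g x) @[x --> F] --> (a, b).
Proof. exact: cvg_pair. Qed.

Lemma cvg_diag (T : topologicalType) (z : T) : (w, w) @[w --> z] --> (z, z).
Proof. by apply: cvg_pair; exact: cvg_id. Qed.

Lemma cvg_map_pair (U V : topologicalType) (f : U -> V) (y : U) :
  {for y, continuous f} -> (f p.1, f p.2) @[p --> (y, y)] --> (f y, f y).
Proof.
move=> fy; have h1 : p.1 @[p --> (y, y)] --> y by exact: cvg_fst.
have h2 : p.2 @[p --> (y, y)] --> y by exact: cvg_snd.
exact: (cvg_prod_nbhs (cvg_comp _ _ h1 fy) (cvg_comp _ _ h2 fy)).
Qed.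

Lemma differentiable_littleo (K : numFieldType) (V W : normedModType K)
    (f : V -> W) (df : {linear V -> W}) (z : V) :
  continuous df -> f \o shift z = cst (f z) + df +o_ 0 id -> differentiable f z.
Proof. by move=> dfc e; apply/diff_locallyP; rewrite (diff_unique dfc e). Qed.

Section Slope.
Variables (K : numFieldType) (n p : nat) (f : 'rV[K]_n -> 'rV[K]_p).
Variables (q : 'rV[K]_n * 'rV[K]_n -> 'M[K]_(n, p)) (z : 'rV[K]_n).

(** [slope_at] asks for continuity at all diagonal points near [(z, z)], which makes it an open
    condition. A local inverse can thus be differentiated on a whole neighbourhood. *)
Lemma slope_at_near : slope_at f q z -> \forall w \near z, slope_at f q w.
Proof.
move=> [/nbhs_interior/cvg_diag fz /nbhs_interior qz].
by near=> w; split; near: w; [exact: fz|exact: qz].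
Unshelve. all: by end_near. Qed.

(** The differential is right multiplication by [q (z, z)]: the remainder is
    [h *m (q (h + z, z) - q (z, z))], whose second factor tends to 0. *)
Lemma slope_differentiable :
  (\forall xy \near (z, z), f xy.1 - f xy.2 = (xy.1 - xy.2) *m q xy) ->
  {for (z, z), continuous q} -> differentiable f z.
Proof.
move=> fz qz.
pose df := mulmxr (q (z, z)) : {linear 'rV[K]_n -> 'rV[K]_p}.
have dfc : continuous df.
  move=> x.
  apply: (@cvg_mulmx K _ (nbhs x) _ 1 n p id (fun=> q (z, z)) x (q (z, z))).
    exact: cvg_id.
  exact: cvg_cst.
pose c (h : 'rV[K]_n) : 'rV[K]_n * 'rV[K]_n := (h + z, z).
have hz : c h @[h --> (0 : 'rV[K]_n)] --> (z, z).
  have h1 : h + z @[h --> (0 : 'rV[K]_n)] --> z.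
    rewrite -[X in _ --> X]add0r.
    exact: (cvgD (cvg_id (F := nbhs (0 : 'rV[K]_n))) (cvg_cst z)).
  exact: (cvg_prod_nbhs h1 (cvg_cst z)).
apply: (differentiable_littleo dfc).
apply/eqaddoP => e e0.
have qhz := cvg_comp _ _ hz qz.
(* The division compensates the factor [n] of [mulmx_norm_le]; the successor keeps the denominator
   non-zero when [n] is 0. *)
have d0 : 0 < e / n.+1%:R by rewrite divr_gt0.
move/cvgrPdist_le : qhz => /(_ _ d0) qhz.
near=> h.
have qh : `|q (z, z) - q (c h)| <= e / n.+1%:R by near: h; exact: qhz.
have : f (c h).1 - f (c h).2 = ((c h).1 - (c h).2) *m q (c h).
  by near: h; exact: hz fz.
rewrite /= addrK => fh.
have -> : (f \o shift z - (cst (f z) + df)) h = h *m (q (c h) - q (z, z)).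
  by rewrite mulmxBr -fh /= !fctE /= opprD addrA.
rewrite (le_trans (mulmx_norm_le _ _))// mulrCA mulrC ler_wpM2r//.
rewrite -normrN opprB (le_trans (ler_wpM2l _ qh))// mulrCA ler_piMr ?(ltW e0)//.
by rewrite ler_pdivrMr// mul1r ler_nat.
Unshelve. all: by end_near. Qed.

End Slope.

(** * Geometric Cauchy sequences *)

Section GeometricCauchy.
Variable R : realType.

(** The intervals of centre [u n] and radius [d n], the tail of the geometric series, are nested;
    the supremum of their left ends lies in all of them. *)
Lemma real_geometric_cvg (u : nat -> R) c :
  (forall n, `|u n.+1 - u n| <= c / 2 ^+ n) ->
  exists l, forall n, `|l - u n| <= 2 * c / 2 ^+ n.
Proof.
move=> uc; pose d n : R := 2 * c / 2 ^+ n.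
have dS n : d n - c / 2 ^+ n = d n.+1.
  rewrite /d exprS invfM mulrACA divff ?pnatr_eq0// mul1r.
  by rewrite mulr_natl mulr2n mulrDl addrK.
have c0 : 0 <= c by have := uc 0; rewrite expr0 divr1; apply: le_trans.
have d0 n : 0 <= d n by rewrite /d divr_ge0 ?mulr_ge0 ?exprn_ge0.
have uS n : u n - d n <= u n.+1 - d n.+1 /\ u n.+1 + d n.+1 <= u n + d n.
  by have := uc n; rewrite ler_norml -dS => /andP[? ?]; split; lra.
have lo m n : (m <= n)%N -> u m - d m <= u n - d n.
  elim: n => [|n IH]; first by rewrite leqn0 => /eqP ->.
  by rewrite leq_eqVlt => /predU1P[->//|/IH/le_trans]; apply; case: (uS n).
have hi m n : (m <= n)%N -> u n + d n <= u m + d m.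
  elim: n => [|n IH]; first by rewrite leqn0 => /eqP ->.
  by rewrite leq_eqVlt => /predU1P[->//|/IH]; apply: le_trans; case: (uS n).
have lohi m n : u m - d m <= u n + d n.
  have := lo _ _ (leq_maxl m n); have := hi _ _ (leq_maxr m n).
  by have := d0 (maxn m n); lra.
pose E := range (fun n => u n - d n).
have E0 : E !=set0 by exists (u 0%N - d 0%N), 0%N.
have Eub n : ubound E (u n + d n) by move=> _ [m _ <-].
exists (sup E) => n; rewrite -/(d n) ler_norml; apply/andP; split.
  have : u n - d n <= sup E.
    by apply: ub_le_sup; [exists (u 0%N + d 0%N)|exists n].
  by lra.
by have := ge_sup E0 (Eub n); lra.
Qed.

Lemma normc_ge_Im (w : R[i]) : (`|complex.Im w|%:C)%C <= `|w|.
Proof.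
have := normc_ge_Re (w * 'i%C); rewrite ReiNIm normrN normrM.
by rewrite [`|'i%C|]normc_def/= expr0n expr1n add0r sqrtr1 mulr1.
Qed.

Lemma normc_le_Re_Im (w : R[i]) :
  `|w| <= (`|complex.Re w| + `|complex.Im w|)%:C%C.
Proof.
rewrite {1}[w]complexE (le_trans (ler_normD _ _))// rmorphD/= lerD// ?normrM.
  by rewrite normc_def/= expr0n addr0 sqrtr_sqr.
rewrite [`|'i%C|]normc_def/= expr0n expr1n add0r sqrtr1 mul1r.
by rewrite normc_def/= expr0n addr0 sqrtr_sqr.
Qed.

(** The real and imaginary parts converge separately, each with constant 2, which add up to 4. The
    bound [c] is non-negative, hence real. *)
Lemma complex_geometric_cvg (u : nat -> R[i]) (c : R[i]) :
  (forall n, `|u n.+1 - u n| <= c / 2 ^+ n) ->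
  exists l, forall n, `|l - u n| <= 4 * c / 2 ^+ n.
Proof.
move=> uc; have c0 : 0 <= c.
  by have := uc 0; rewrite expr0 divr1; apply: le_trans.
have [r cr] : exists r : R, c = r%:C%C.
  by apply/complex_realP; rewrite ger0_real.
have nE n (k : R) : k%:C%C * c / 2 ^+ n = (k * r / 2 ^+ n)%:C%C.
  by rewrite cr !rmorphM/= fmorphV rmorphXn rmorph_nat.
have cE n : c / 2 ^+ n = (r / 2 ^+ n)%:C%C.
  by have := nE n 1; rewrite !mul1r.
have [a ha] : exists a, forall n, `|a - complex.Re (u n)| <= 2 * r / 2 ^+ n.
  apply: real_geometric_cvg => n; rewrite -lecR -cE (le_trans _ (uc n))//.
  rewrite (le_trans _ (normc_ge_Re _))// lecR.
  by case: (u n) (u n.+1) => [? ?] [].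
have [b hb] : exists b, forall n, `|b - complex.Im (u n)| <= 2 * r / 2 ^+ n.
  apply: real_geometric_cvg => n; rewrite -lecR -cE (le_trans _ (uc n))//.
  rewrite (le_trans _ (normc_ge_Im _))// lecR.
  by case: (u n) (u n.+1) => [? ?] [].
exists (a +i* b)%C => n; rewrite (le_trans (normc_le_Re_Im _))//.
have -> : 4 * c / 2 ^+ n = (2 * r / 2 ^+ n + 2 * r / 2 ^+ n)%:C%C.
  by rewrite -!mulrDl -natrD -nE rmorph_nat.
by rewrite lecR; case: (u n) (ha n) (hb n) => [x y] /= ? ?; rewrite lerD.
Qed.

Lemma rV_geometric_cvg p (u : nat -> 'rV[Cplx R]_p) (c : Cplx R) :
  (forall n, `|u n.+1 - u n| <= c / 2 ^+ n) ->
  exists l, forall n, `|l - u n| <= 4 * c / 2 ^+ n.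
Proof.
move=> uc; have c0 : 0 <= c.
  by have := uc 0; rewrite expr0 divr1; apply: le_trans.
have /choice[l hl] j :
    exists l : Cplx R, forall n, `|l - u n 0 j| <= 4 * c / 2 ^+ n.
  apply: complex_geometric_cvg => n; apply: le_trans (uc n).
  by have := le_mx_norm (u n.+1 - u n) 0 j; rewrite !mxE.
exists (\row_j l j) => n; apply: mx_norm_le => [|i j].
  by rewrite divr_ge0 ?mulr_ge0 ?exprn_ge0.
by rewrite ord1 !mxE.
Qed.

(** Both numbers are non-negative, hence real, and the reals are archimedean: a power of 2 exceeds
    [s / r] if [r] is positive. *)
Lemma geometric_le0 (a c : Cplx R) :
  0 <= a -> (forall n, a <= c / 2 ^+ n) -> a = 0.
Proof.
move=> a0 ac; have := ac 0; rewrite expr0 divr1 => /(le_trans a0) c0.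
have [r ar] : exists r : R, a = (r%:C : R[i])%C.
  by apply/complex_realP; rewrite ger0_real.
have [s cs] : exists s : R, c = (s%:C : R[i])%C.
  by apply/complex_realP; rewrite ger0_real.
rewrite ar; congr (_%:C)%C; apply/eqP; rewrite eq_le.
have -> : 0 <= r by rewrite -lecR -ar.
rewrite andbT leNgt; apply/negP => r0.
have rs n : r <= s / 2 ^+ n.
  by rewrite -lecR rmorphM/= fmorphV rmorphXn rmorph_nat -ar -cs.
have s0 : 0 <= s / r by rewrite divr_ge0 ?(ltW r0)// -lecR -cs.
have := rs (Num.bound (s / r)).
rewrite ler_pdivlMr ?exprn_gt0// leNgt => /negP; apply.
rewrite mulrC -ltr_pdivrMr// (lt_le_trans (archi_boundP s0))//.
by rewrite -natrX ler_nat ltnW// ltn_expl.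
Qed.

End GeometricCauchy.

(** * The inverse function theorem *)

(** Halving the radius of an open ball gives a closed one, which the limit of an iteration does not
    leave. *)
Lemma near_pair_closed_ball (K : numFieldType) (V : normedModType K)
    (P : set (V * V)) (z : V) :
  nbhs (z, z) P -> exists2 r : K, 0 < r &
    forall x y, `|x - z| <= r -> `|y - z| <= r -> P (x, y).
Proof.
move=> /nbhs_ballP[r /= r0 rP]; have r20 : 0 < r / 2 by rewrite divr_gt0.
have ltr : r / 2 < r by rewrite ltr_pdivrMr// ltr_pMr// ltr1n.
exists (r / 2) => // x y xr yr; apply: (rP (x, y)).
by split; rewrite -ball_normE /= distrC (le_lt_trans _ ltr).
Qed.

Lemma continuous_dominated (K : numFieldType) (U V W : normedModType K)
    (f : U -> V) (g : U -> W) (c : K) (y : U) :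
  0 < c -> (\forall x \near y, `|f y - f x| <= c * `|g y - g x|) ->
  {for y, continuous g} -> {for y, continuous f}.
Proof.
move=> c0 fg gy; apply/cvgrPdist_le => e e0.
have ec0 : 0 < e / c by rewrite divr_gt0.
near=> x; have fgx : `|f y - f x| <= c * `|g y - g x| by near: x.
rewrite (le_trans fgx)// mulrC -ler_pdivlMr//.
by near: x; move/cvgrPdist_le : gy; apply.
Unshelve. all: by end_near. Qed.

Section InverseFunction.
Variables (R : realType) (n : nat).
Notation K := (Cplx R).
Notation V := 'rV[K]_n.

(* Newton-like iteration [u - (G u - y)], convergent because [G - id] is a    *)
(* contraction.                                                               *)
Lemma near_identity_surj (G : V -> V) (z : V) (r : K) :
  0 < r ->
  (forall x y : V, `|x - z| <= r -> `|y - z| <= r ->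
     `|G x - G y - (x - y)| <= `|x - y| / 2) ->
  forall y : V, `|y - G z| <= r / 4 -> exists2 x : V, `|x - z| <= r & G x = y.
Proof.
move=> r0 Gid y yr.
pose u := fix u n := if n is k.+1 then u k - (G (u k) - y) else z.
pose c : K := `|y - G z|; have c0 : 0 <= c by exact: normr_ge0.
have cr : 4 * c <= r by rewrite mulrC -ler_pdivlMr.
have c2r : 2 * c <= r.
  by rewrite (le_trans _ cr)// ler_wpM2r// ler_nat.
have half m : c / 2 ^+ m = c / 2 ^+ m.+1 + c / 2 ^+ m.+1.
  by rewrite exprSr invfM !mulrA -splitr.
have in_ball m x : `|x - z| <= 2 * (c - c / 2 ^+ m) -> `|x - z| <= r.
  move=> /le_trans; apply; apply: le_trans c2r.
  by rewrite ler_wpM2l// gerBl divr_ge0// exprn_ge0.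
(* Both bounds are proved together: the steps halve, and the distance to [z] is at most the partial
   sum of the geometric series, so the iterates stay where [Gid] applies. *)
have uP m : `|u m - z| <= 2 * (c - c / 2 ^+ m) /\ `|u m.+1 - u m| <= c / 2 ^+ m.
  elim: m => [|m [IH1 IH2]].
    rewrite /= !subrr !expr0 !divr1 subrr mulr0 normr0.
    by rewrite addrC addKr opprB lexx.
  have uS1 : `|u m.+1 - z| <= 2 * (c - c / 2 ^+ m.+1).
    rewrite -(subrKA (u m)) (le_trans (ler_normD _ _))//.
    apply: le_trans (lerD IH2 IH1) _; rewrite [in leLHS]half.
    rewrite le_eqVlt; apply/orP; left; apply/eqP; ring.
  split=> //.
  (* Two consecutive steps differ by the error of [G] with respect to the identity, which [Gid]
     bounds by half of the previous step. *)
  have -> : u m.+2 - u m.+1 = - (G (u m.+1) - G (u m) - (u m.+1 - u m)).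
    rewrite [u m.+2]/= -/(u m.+1) addrAC subrr sub0r.
    have -> : u m.+1 - u m = - (G (u m) - y) by rewrite /= addrAC subrr sub0r.
    by rewrite opprK addrA subrK.
  rewrite normrN (le_trans (Gid _ _ _ _))//; try exact: in_ball.
    exact: in_ball uS1.
  exact: in_ball IH1.
  by rewrite exprSr invfM mulrA ler_wpM2r// invr_ge0.
have [x hx] := rV_geometric_cvg (fun m => (uP m).2).
(* Since [z] is [u 0], the limit is within [4 * c] of [z]; this is the origin of the radius
   [r / 4]. *)
have xr : `|x - z| <= r.
  by have := hx 0%N; rewrite expr0 divr1 => /le_trans; apply.
exists x => //; apply/eqP; rewrite -subr_eq0 -normr_eq0; apply/eqP.
(* As [G (u m) - y] is [u m - u m.+1], three terms remain, with constants 2 (half of 4, by [Gid]), 4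
   (the distance from [x] to [u m]) and 1 (the step). *)
apply: (@geometric_le0 _ _ (7 * c)) => // m.
have um : `|u m - z| <= r by exact: in_ball (uP m).1.
have -> : G x - y = (G x - G (u m) - (x - u m)) + (x - u m) + (u m - u m.+1).
  by rewrite subrK /= subKr addrA subrK.
have -> : 7 * c / 2 ^+ m = 2 * c / 2 ^+ m + 4 * c / 2 ^+ m + c / 2 ^+ m by ring.
rewrite (le_trans (ler_normD _ _))//.
rewrite lerD//; last by rewrite distrC (uP m).2.
rewrite (le_trans (ler_normD _ _))// lerD ?hx//.
rewrite (le_trans (Gid _ _ _ _))// ler_pdivrMr// (le_trans (hx m))//.
rewrite le_eqVlt; apply/orP; left; apply/eqP; ring.
Qed.

(** Composed with the inverse [B] of the slope at [(z, z)], [F] becomes a small perturbation of the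
    identity, to which the iteration applies. *)
Theorem inverse_function (F : V -> V) (Q : V * V -> 'M[K]_n) (z : V) :
  slope_at F Q z -> Q (z, z) \in unitmx ->
  exists Phi : V -> V,
    (\forall y \near F z, differentiable Phi y /\ F (Phi y) = y) /\
    (\forall w \near z, Phi (F w) = w).
Proof.
move=> FQ Au; have [Fz /nbhs_singleton Qz] := FQ; set B := invmx (Q (z, z)).
have BK (x : V) : x *m B = 0 -> x = 0.
  by move=> xB; rewrite -(mulmxKV Au x) xB mul0mx.
(* With the factor [n] of [mulmx_norm_le], this makes the contraction constant at most 1/2. *)
pose e : K := (2 * n.+1%:R)^-1.
have e0 : 0 < e by rewrite invr_gt0 mulr_gt0.
have QB : \forall xy \near (z, z), `|1%:M - Q xy *m B| <= e.
  have : Q xy *m B @[xy --> (z, z)] --> (1%:M : 'M[K]_n).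
    rewrite -(mulmxV Au); exact: (cvg_mulmx Qz (cvg_cst B)).
  by move/cvgrPdist_le; apply.
have [r r0 rP] : exists2 r : K, 0 < r & forall x y : V,
    `|x - z| <= r -> `|y - z| <= r ->
    F x - F y = (x - y) *m Q (x, y) /\ `|1%:M - Q (x, y) *m B| <= e.
  have [r r0 rP] := near_pair_closed_ball (filterI Fz QB).
  by exists r => // x y xr yr; exact: (rP x y xr yr).
pose G x := F x *m B.
have Gid (x y : V) : `|x - z| <= r -> `|y - z| <= r ->
    `|G x - G y - (x - y)| <= `|x - y| / 2.
  move=> xr yr; have [Fxy Qxy] := rP _ _ xr yr.
  have -> : G x - G y - (x - y) = (x - y) *m (Q (x, y) *m B - 1%:M).
    by rewrite mulmxBr mulmx1 mulmxA -Fxy mulmxBl.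
  rewrite distrC in Qxy.
  rewrite (le_trans (mulmx_norm_le _ _))// mulrCA ler_wpM2l//.
  rewrite (le_trans (ler_wpM2l _ Qxy))// /e invfM mulrCA ler_piMr// ?invr_ge0//.
  by rewrite ler_pdivrMr// mul1r ler_nat.
have Ginj (x y : V) : `|x - z| <= r -> `|y - z| <= r ->
    `|x - y| <= 2 * `|G x - G y|.
  move=> xr yr; rewrite mulrC -ler_pdivrMr// -(lerD2r (`|x - y| / 2)) -splitr.
  apply: le_trans (lerD (lexx _) (Gid _ _ xr yr)).
  by rewrite -[X in `|X| <= _](subKr (G x - G y)) ler_normB.
pose good (x y : V) := `|x - z| <= r /\ F x = y.
(* A preimage in the closed ball is unique by [Ginj]; where there is none, [get] returns an
   arbitrary value. *)
pose Phi (y : V) : V := get (fun x => good x y).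
have PhiP y : (exists x, good x y) -> good (Phi y) y by exact: getPex.
have goodF : \forall y \near F z, good (Phi y) y.
  have : y *m B @[y --> F z] --> G z.
    exact: (cvg_mulmx (cvg_id (F := nbhs (F z))) (cvg_cst B)).
  have r40 : 0 < r / 4 by rewrite divr_gt0.
  move=> /cvgrPdist_le/(_ _ r40); apply: filterS => y yr.
  rewrite distrC in yr; have [x xr xy] := near_identity_surj r0 Gid yr.
  apply: PhiP; exists x; split=> //; apply/eqP; rewrite -subr_eq0; apply/eqP/BK.
  by rewrite mulmxBl -xy subrr.
have PhiF (x : V) : `|x - z| <= r -> Phi (F x) = x.
  move=> xr; have [Pr PF] : good (Phi (F x)) (F x) by apply: PhiP; exists x.
  apply/eqP; rewrite -subr_eq0 -normr_le0 (le_trans (Ginj _ _ Pr xr))//.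
  by rewrite /G PF subrr normr0 mulr0.
exists Phi; split; last first.
  have /cvgrPdist_le/(_ r r0) := cvg_id (F := nbhs z).
  by apply: filterS => w; rewrite distrC; exact: PhiF.
(* [Ginj] read at preimages says that [Phi] is Lipschitz with respect to [y *m B]. *)
have Phic : \forall y \near F z, {for y, continuous Phi}.
  apply: filterS (nbhs_interior goodF) => y yg.
  have [yr yF] := nbhs_singleton yg.
  apply: (@continuous_dominated K V V V Phi (fun x : V => x *m B) 2 y).
  - exact: ltr0n.
  - apply: filterS yg => x [xr xF].
    by have := Ginj _ _ yr xr; rewrite /G yF xF.
  - exact: (cvg_mulmx (cvg_id (F := nbhs (y : V))) (cvg_cst B)).
have PhiFz : Phi (F z) = z by apply: PhiF; rewrite subrr normr0 ltW.
have slopePhi : \forall y \near F z,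
    slope_at F Q (Phi y) /\ Q (Phi y, Phi y) \in unitmx.
  have Phiz : Phi y @[y --> F z] --> z.
    by rewrite -[X in _ --> X]PhiFz; exact: nbhs_singleton Phic.
  have S : \forall w \near z, slope_at F Q w /\ Q (w, w) \in unitmx.
    apply: filterI; first exact: slope_at_near.
    have Qd : Q (w, w) @[w --> z] --> Q (z, z).
      by apply: (cvg_comp _ _ (@cvg_diag V z) Qz).
    exact: (@cvg_unitmx K V (nbhs z) _ n (fun w => Q (w, w)) _ Qd Au).
  exact: (cvg_near Phiz S).
apply: filterS3 (nbhs_interior goodF) Phic slopePhi.
move=> y yg yc [[Fy /nbhs_singleton Qy] Qyu].
have [yr yF] := nbhs_singleton yg; split; last exact: yF.
have PhiPhi : (Phi yy.1, Phi yy.2) @[yy --> (y, y)] --> (Phi y, Phi y).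
  exact: (@cvg_map_pair V V Phi y yc).
have QPhi := cvg_comp _ _ PhiPhi Qy.
(* The slope of the inverse is the inverse of the slope of [F], taken at the two preimages. *)
pose P (yy : V * V) := invmx (Q (Phi yy.1, Phi yy.2)).
apply: (@slope_differentiable _ _ _ Phi P); last exact: (cvg_invmx QPhi Qyu).
near=> yy.
have yyu : Q (Phi yy.1, Phi yy.2) \in unitmx.
  by near: yy; exact: (cvg_unitmx QPhi Qyu).
have : F (Phi yy.1) - F (Phi yy.2)
    = (Phi yy.1 - Phi yy.2) *m Q (Phi yy.1, Phi yy.2).
  by near: yy; exact: (cvg_near PhiPhi Fy).
have [g1 g2] : good (Phi yy.1) yy.1 /\ good (Phi yy.2) yy.2.
  split; near: yy.
    have h : p.1 @[p --> (y : V, y : V)] --> (y : V) by exact: cvg_fst.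
    exact: (cvg_near h yg).
  have h : p.2 @[p --> (y : V, y : V)] --> (y : V) by exact: cvg_snd.
  exact: (cvg_near h yg).
by rewrite g1.2 g2.2 => ->; rewrite mulmxK.
Unshelve. all: by end_near. Qed.



End InverseFunction.

(** * The complex exponential and its local inverses *)

(** One-variable counterpart of [slope_at], with scalar slopes, which can be divided by one
    another. *)
Definition scalar_slope_at (K : numFieldType) (f : K -> K) (q : K * K -> K)
    (a : K) :=
  (\forall p \near (a, a), f p.1 - f p.2 = q p * (p.1 - p.2)) /\
  (\forall w \near a, {for (w, w), continuous q}).

Section ComplexExponential.
Variable R : realType.
Notation K := (Cplx R).

Lemma near_Re_Im (P Q : R -> Prop) :
  (\forall x \near 0, P x) -> (\forall x \near 0, Q x) ->
  \forall h \near (0 : K),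
    P (complex.Re (h : R[i])) /\ Q (complex.Im (h : R[i])).
Proof.
move=> P0 Q0.
have /nbhs_ballP[d /= d0 dPQ] : \forall x \near (0 : R), P x /\ Q x.
  exact: filterI P0 Q0.
have dC : 0 < (d%:C%C : K) by rewrite ltcR.
have /cvgrPdist_lt/(_ _ dC) := cvg_id (F := nbhs (0 : K)).
apply: filterS => -[x y]; rewrite sub0r normrN => hd.
split.
  apply: (dPQ x _).1; rewrite -ball_normE /= sub0r normrN -ltcR.
  exact: le_lt_trans (normc_ge_Re (x +i* y)%C) hd.
apply: (dPQ y _).2; rewrite -ball_normE /= sub0r normrN -ltcR.
exact: le_lt_trans (normc_ge_Im (x +i* y)%C) hd.
Qed.

Lemma derive_near (f : R -> R) (a d e : R) : is_derive a 1 f d -> 0 < e ->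
  \forall h \near 0, `|f (h + a) - f a - h * d| <= e * `|h|.
Proof.
move=> [df fd] e0; have /derivable_nbhs := df.
move=> /eqaddoP/(_ _ e0); apply: filterS => h /=.
by rewrite fd !fctE /= -[h *: 1]/(h * 1) mulr1 opprD addrA.
Qed.

Lemma cexp0 : cexp (0 : K) = 1.
Proof. by rewrite /cexp /= expR0 cos0 sin0 mulr1 mulr0. Qed.

Lemma cexpD (u v : K) : cexp (u + v) = cexp u * cexp v.
Proof.
case: u v => [a b] [c d]; rewrite /cexp /= expRD cosD sinD.
by apply/eqP; rewrite eq_complex /=; apply/andP; split; apply/eqP; ring.
Qed.

Lemma cexp_neq0 (u : K) : cexp u != 0.
Proof.
have : cexp u * cexp (- u) = 1 by rewrite -cexpD subrr cexp0.
by move=> h; apply/eqP => u0; move/eqP: h; rewrite u0 mul0r eq_sym oner_eq0.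
Qed.

Lemma cexp_sum (I : Type) (r : seq I) (P : pred I) (F : I -> K) :
  cexp (\sum_(i <- r | P i) F i) = \prod_(i <- r | P i) cexp (F i).
Proof. exact: (big_morph _ cexpD cexp0). Qed.

Lemma cexpMn (u : K) n : cexp (n%:R * u) = cexp u ^+ n.
Proof.
rewrite mulr_natl; elim: n => [|n IH]; first by rewrite cexp0.
by rewrite mulrS exprS cexpD IH.
Qed.

(** The value 1 at 0 is the derivative of exp there, so that the quotient is continuous at 0. *)
Definition cexp_quot (h : K) : K := if h == 0 then 1 else (cexp h - 1) / h.

Lemma cexp_quotE (h : K) : cexp h - 1 = cexp_quot h * h.
Proof.
rewrite /cexp_quot; case: eqVneq => [->|h0]; last by rewrite divfK.
by rewrite cexp0 subrr mulr0.
Qed.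

(** Complex differentiability at 0, with derivative 1, follows from the derivatives at 0 of the real
    functions exp, cos and sin, by estimating real and imaginary parts. *)
Lemma cexp_near0 (e : K) : 0 < e ->
  \forall h \near (0 : K), `|cexp h - 1 - h| <= e * `|h|.
Proof.
move=> e0; have [r er] : exists r : R, e = (r%:C : R[i])%C.
  by apply/complex_realP; rewrite gtr0_real.
have r0 : 0 < r by rewrite -ltcR -er.
(* The real and imaginary errors are each at most [3 * s * N], [N] being the modulus, so their sum
   is below [r * N]; [s <= 1] gives [expR x <= 2]. *)
pose s := Num.min (r / 8) 1.
have s0 : 0 < s by rewrite lt_min divr_gt0//=.
have expR_near := derive_near (is_derive_expR 0) s0.
have cos_near := derive_near (is_derive_cos 0) s0.
have sin_near := derive_near (is_derive_sin 0) s0.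
have small : \forall x \near (0 : R), `|x| <= s / 2.
  have s20 : 0 < s / 2 by rewrite divr_gt0.
  have /cvgrPdist_le/(_ _ s20) := cvg_id (F := nbhs (0 : R)).
  by apply: filterS => x; rewrite sub0r normrN.
apply: filterS
  (near_Re_Im (filterI expR_near small) (filterI cos_near sin_near)).
move=> [x y] /= [[hx xs] [hc hs]].
rewrite addr0 expR0 mulr1 in hx.
rewrite addr0 cos0 sin0 oppr0 mulr0 subr0 in hc.
rewrite addr0 cos0 sin0 mulr1 subr0 in hs.
have s1 : s <= 1 by rewrite ge_min lexx orbT.
have sr : s <= r / 8 by rewrite ge_min lexx.
pose N := complex.Re `|(x +i* y)%C|.
have NE : (N%:C)%C = `|(x +i* y)%C| by rewrite RRe_real// normr_real.
have xN : `|x| <= N by rewrite -lecR NE (normc_ge_Re (x +i* y)%C).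
have yN : `|y| <= N by rewrite -lecR NE (normc_ge_Im (x +i* y)%C).
have N0 : 0 <= N := le_trans (normr_ge0 _) xN.
have e1 : `|expR x - 1| <= s.
  have -> : expR x - 1 = expR x - 1 - x + x by rewrite subrK.
  rewrite (le_trans (ler_normD _ _))// (le_trans (lerD hx xs))//.
  by have := normr_ge0 x; nra.
have e2 : `|expR x| <= 2.
  by have := ler_normD (expR x - 1) 1; rewrite subrK normr1; lra.
have hA : `|expR x * cos y - 1 - x| <= 3 * s * N.
  have -> : expR x * cos y - 1 - x = (expR x - 1 - x) + expR x * (cos y - 1).
    by ring.
  rewrite (le_trans (ler_normD _ _))// normrM.
  have := ler_pM (normr_ge0 _) (normr_ge0 _) e2 hc.
  by have := ler_wpM2l (ltW s0) xN; have := ler_wpM2l (ltW s0) yN; lra.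
have hB : `|expR x * sin y - y| <= 3 * s * N.
  have -> : expR x * sin y - y = expR x * (sin y - y) + (expR x - 1) * y.
    by ring.
  rewrite (le_trans (ler_normD _ _))// !normrM.
  have := ler_pM (normr_ge0 _) (normr_ge0 _) e2 hs.
  have := ler_pM (normr_ge0 _) (normr_ge0 _) e1 (lexx `|y|).
  by have := ler_wpM2l (ltW s0) yN; lra.
rewrite er -NE -rmorphM/=; apply: le_trans (normc_le_Re_Im _) _.
rewrite lecR /= ?(oppr0, addr0) (le_trans (lerD hA hB))//.
by have := ler_wpM2r N0 sr; have := mulr_ge0 (ltW r0) N0; lra.
Qed.

Lemma cexp_quot_cvg0 : cexp_quot h @[h --> (0 : K)] --> (1 : K).
Proof.
apply/(@cvgrPdist_le K K K (nbhs (0 : K))) => e e0.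
apply: filterS (cexp_near0 e0) => h he.
have [->|h0] := eqVneq h 0; first by rewrite /cexp_quot eqxx subrr normr0 ltW.
rewrite -(ler_pM2r (_ : 0 < `|h|)) ?normr_gt0// -normrM mulrBl mul1r.
rewrite -cexp_quotE.
by rewrite distrC.
Qed.

(** The divided difference of exp, written by means of the functional equation so that it extends to
    the diagonal, with value [cexp u] at [(u, u)]. *)
Definition cexp_slope (p : K * K) : K := cexp p.2 * cexp_quot (p.1 - p.2).

Lemma cexp_slopeE (u v : K) : cexp u - cexp v = cexp_slope (u, v) * (u - v).
Proof.
rewrite /cexp_slope /= -mulrA -cexp_quotE mulrBr mulr1 -cexpD.
by rewrite [v + _]addrC subrK.
Qed.

Lemma cexp_slope_diag (u : K) : cexp_slope (u, u) = cexp u.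
Proof. by rewrite /cexp_slope /= subrr /cexp_quot eqxx mulr1. Qed.

Lemma cvg_cexp_quot_sub (T : Type) (F : set_system T) {FF : Filter F}
    (f g : T -> K) (a : K) :
  f x @[x --> F] --> a -> g x @[x --> F] --> a ->
  cexp_quot (f x - g x) @[x --> F] --> (1 : K).
Proof.
move=> fa ga; have fg : f x - g x @[x --> F] --> (0 : K).
  by rewrite -(subrr a); exact: cvgB.
exact: (cvg_comp _ _ fg cexp_quot_cvg0).
Qed.

Lemma cexp_continuous (a : K) : cexp w @[w --> a] --> cexp a.
Proof.
have idK : w @[w --> a] --> a by exact: cvg_id.
have h1 : cexp_quot (w - a) @[w --> a] --> (1 : K).
  exact: (cvg_cexp_quot_sub idK (cvg_cst a)).
have h2 : w - a @[w --> a] --> (0 : K).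
  by rewrite -(subrr a); exact: (cvgB idK (cvg_cst a)).
have h : cexp a + cexp a * (cexp_quot (w - a) * (w - a)) @[w --> a]
    --> cexp a + cexp a * (1 * 0).
  exact: (cvgD (cvg_cst _) (cvgM (cvg_cst _) (cvgM h1 h2))).
rewrite mulr0 mulr0 addr0 in h.
have E : (fun w : K => cexp a + cexp a * (cexp_quot (w - a) * (w - a)))
    = @cexp R.
  apply/funext => w; have := cexp_slopeE w a.
  rewrite /cexp_slope /= mulrA => <-.
  by rewrite addrC subrK.
by rewrite E in h.
Qed.

Lemma cvg_cexp_slope (T : Type) (F : set_system T) {FF : Filter F}
    (f g : T -> K) (a : K) :
  f x @[x --> F] --> a -> g x @[x --> F] --> a ->
  cexp_slope (f x, g x) @[x --> F] --> cexp a.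
Proof.
move=> fa ga; rewrite -[cexp a]mulr1.
exact: (cvgM (cvg_comp _ _ ga (@cexp_continuous a)) (cvg_cexp_quot_sub fa ga)).
Qed.

(** The divided difference between [f x] and [a] tends to [cexp a], which is non-zero, so it is
    eventually non-zero. *)
Lemma cexp_locally_injective (T : Type) (F : set_system T) {FF : Filter F}
    (f : T -> K) (a : K) :
  f x @[x --> F] --> a ->
  \forall x \near F, cexp (f x) = cexp a -> f x = a.
Proof.
move=> fa; have h : cexp_slope (f x, a) @[x --> F] --> cexp a.
  exact: (cvg_cexp_slope fa (cvg_cst a)).
have := @cvgr_neq0 _ _ _ _ FF _ _ h (cexp_neq0 a); apply: filterS => x s0 e.
apply/eqP; rewrite -subr_eq0; have /eqP := cexp_slopeE (f x) a.
by rewrite e subrr eq_sym mulf_eq0 (negPf s0).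
Qed.

(** Since [cexp] undoes [l], the slope of [s] is the product of the slopes of [cexp] and [l \o s];
    the one of [cexp] is non-zero near the diagonal point and can be divided out. *)
Lemma log_scalar_slope (l s : K -> K) (qs : K * K -> K) (b : K) :
  log_branch (s b) l -> scalar_slope_at s qs b ->
  (\forall w \near b, {for w, continuous s}) ->
  [/\ scalar_slope_at (l \o s)
        (fun p => qs p / cexp_slope (l (s p.1), l (s p.2))) b,
      \forall w \near b, cexp (l (s w)) = s w &
      \forall w \near b, {for w, continuous (l \o s)}].
Proof.
move=> hl [sq qc] sc.
have sb : s w @[w --> b] --> s b by exact: nbhs_singleton sc.
have hls : \forall w \near b, cexp (l (s w)) = s w /\ {for s w, continuous l}.
  exact: (cvg_near sb hl).
have lsc : \forall w \near b, {for w, continuous (l \o s)}.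
  by apply: filterS2 sc hls => w sw [_ lw]; exact: (cvg_comp _ _ sw lw).
split; last exact: lsc; last by apply: filterS hls => w [].
have slope_ls w : {for w, continuous (l \o s)} ->
    cexp_slope (l (s p.1), l (s p.2)) @[p --> (w, w)] --> cexp (l (s w)).
  move=> c; have h1 : p.1 @[p --> (w, w)] --> w by exact: cvg_fst.
  have h2 : p.2 @[p --> (w, w)] --> w by exact: cvg_snd.
  exact: (cvg_cexp_slope (cvg_comp _ _ h1 c) (cvg_comp _ _ h2 c)).
split; last first.
  apply: filterS2 qc lsc => w qw cw.
  have h : qs p / cexp_slope (l (s p.1), l (s p.2)) @[p --> (w, w)]
      --> qs (w, w) / cexp_slope (l (s w), l (s w)).
    rewrite cexp_slope_diag.
    exact: (cvgM qw (cvgV (cexp_neq0 _) (slope_ls _ cw))).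
  exact: h.
have n0 : \forall p \near (b, b), cexp_slope (l (s p.1), l (s p.2)) != 0.
  exact: (cvgr_neq0 _ (slope_ls _ (nbhs_singleton lsc)) (cexp_neq0 _)).
have h1 : p.1 @[p --> (b, b)] --> b by exact: cvg_fst.
have h2 : p.2 @[p --> (b, b)] --> b by exact: cvg_snd.
have hl0 : \forall w \near b, cexp (l (s w)) = s w.
  by apply: filterS hls => w [].
have hfst := cvg_near h1 hl0; have hsnd := cvg_near h2 hl0.
near=> p.
have p0 : cexp_slope (l (s p.1), l (s p.2)) != 0 by near: p; exact: n0.
have p1 : cexp (l (s p.1)) = s p.1 by near: p; exact: hfst.
have p2 : cexp (l (s p.2)) = s p.2 by near: p; exact: hsnd.
have p3 : s p.1 - s p.2 = qs p * (p.1 - p.2) by near: p; exact: sq.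
apply: (mulfI p0); rewrite -cexp_slopeE p1 p2 p3.
by rewrite mulrA [cexp_slope _ * _]mulrC divfK.
Unshelve. all: by end_near. Qed.

End ComplexExponential.

(** * Logarithms of shape parameters *)

(** One point of the slope is fixed at [a], so [W] has a single argument. Along the line
    [t *: v + a] the difference quotient is an entry of [v *m W]. *)
Lemma slope_derive (K : numFieldType) k p (f : 'rV[K]_k -> K) (a : 'rV[K]_k)
    (W : 'rV[K]_k -> 'M[K]_(k, p)) (A : 'M[K]_(k, p)) (j : 'I_p)
    (v : 'rV[K]_k) :
  (\forall h \near a, f h - f a = ((h - a) *m W h) 0 j) ->
  W h @[h --> a] --> A -> 'D_v f a = (v *m A) 0 j.
Proof.
move=> fW WA; apply: cvg_lim => //.
pose c (t : K) : 'rV[K]_k := t *: v + a.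
have id0 : t @[t --> (0 : K)^'] --> (0 : K) by exact: nbhs_dnbhs.
have ta : c t @[t --> (0 : K)^'] --> a.
  have h1 : t *: v @[t --> (0 : K)^'] --> 0 *: v.
    exact: (cvgZr_tmp (a := v) id0).
  by have := cvgD h1 (cvg_cst a); rewrite scale0r add0r; apply.
have lim : (v *m W (c t)) 0 j @[t --> (0 : K)^'] --> (v *m A) 0 j.
  apply: cvg_coord; exact: (cvg_mulmx (cvg_cst v) (cvg_comp _ _ ta WA)).
have fW' := cvg_near ta fW.
have t0 : \forall t \near (0 : K)^', t != 0 by exact: nbhs_dnbhs_neq.
apply: cvg_trans lim; apply: near_eq_cvg.
near=> t => /=.
have -> : f (t *: v + a) - f a = ((t *: v + a - a) *m W (t *: v + a)) 0 j.
  by near: t; exact: fW'.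
have tn0 : t != 0 by near: t; exact: t0.
have tE (B : 'rV[K]_p) : (t *: B) 0 j = t * B 0 j by rewrite mxE.
by rewrite addrK -scalemxAl tE -[RHS]/(t^-1 * (t * _)) mulKf.
Unshelve. all: by end_near. Qed.

Section RationalSlopes.
Variable K : numFieldType.

Lemma near_neq (a b : K) : b != a -> \forall w \near b, w != a.
Proof.
move=> ba; have h : w - a @[w --> b] --> b - a.
  exact: (cvgB (cvg_id (F := nbhs b)) (cvg_cst a)).
rewrite -subr_eq0 in ba.
have h0 : \forall w \near b, w - a != 0 by exact: (cvgr_neq0 _ h ba).
by apply: filterS h0 => w; rewrite subr_eq0.
Qed.

Lemma near_pair_fst_snd (P : set K) (b : K) :
  nbhs b P -> \forall p \near (b, b), P p.1 /\ P p.2.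
Proof.
move=> bP; have h1 : p.1 @[p --> (b, b)] --> b by exact: cvg_fst.
have h2 : p.2 @[p --> (b, b)] --> b by exact: cvg_snd.
by apply: filterI; [exact: (cvg_near h1 bP)|exact: (cvg_near h2 bP)].
Qed.

Let cf (w : K) : p.1 @[p --> (w, w)] --> w. Proof. exact: cvg_fst. Qed.
Let cs (w : K) : p.2 @[p --> (w, w)] --> w. Proof. exact: cvg_snd. Qed.

Lemma id_scalar_slope (b : K) :
  scalar_slope_at (fun w : K => w) (fun=> 1) b /\
  (\forall w \near b, {for w, continuous (fun w : K => w)}).
Proof.
split; last by near=> w; exact: cvg_id.
split; first by near=> p; rewrite mul1r.
by near=> w; exact: cvg_cst.
Unshelve. all: by end_near. Qed.

Lemma inv_onem_scalar_slope (b : K) : b != 1 ->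
  scalar_slope_at (fun w : K => (1 - w)^-1)
    (fun p => ((1 - p.1) * (1 - p.2))^-1) b
  /\ (\forall w \near b, {for w, continuous (fun w : K => (1 - w)^-1)}).
Proof.
move=> b1; have n1 := near_neq b1; have p1 := near_pair_fst_snd n1.
have s1 (w : K) : w != 1 -> 1 - w != 0 by rewrite subr_eq0 eq_sym.
have c1 (w : K) : 1 - x @[x --> w] --> 1 - w.
  exact: (cvgB (cvg_cst (1 : K)) (cvg_id (F := nbhs w))).
split; last by apply: filterS n1 => w /s1 w1; exact: (cvgV w1 (c1 w)).
split.
  apply: filterS p1 => -[u v] [/= /s1 u1 /s1 v1].
  by field; rewrite u1 v1.
apply: filterS n1 => w /s1 w1.
have w11 : (1 - w) * (1 - w) != 0 by rewrite mulf_neq0.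
have h1 : (fun p : K * K => 1 - p.1) @ (w, w) --> 1 - w.
  by apply: cvgB; [exact: cvg_cst|exact: cf].
have h2 : (fun p : K * K => 1 - p.2) @ (w, w) --> 1 - w.
  by apply: cvgB; [exact: cvg_cst|exact: cs].
exact: (cvgV w11 (cvgM h1 h2)).
Qed.

Lemma onem_inv_scalar_slope (b : K) : b != 0 ->
  scalar_slope_at (fun w : K => 1 - w^-1) (fun p => (p.1 * p.2)^-1) b
  /\ (\forall w \near b, {for w, continuous (fun w : K => 1 - w^-1)}).
Proof.
move=> b0; have n0 := near_neq b0; have p0 := near_pair_fst_snd n0.
split; last first.
  apply: filterS n0 => w w0.
  exact: (cvgB (cvg_cst (1 : K)) (cvgV w0 (cvg_id (F := nbhs w)))).
split.
  by apply: filterS p0 => -[u v] [/= u0 v0]; field; rewrite u0 v0.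
apply: filterS n0 => w w0; have ww0 : w * w != 0 by rewrite mulf_neq0.
have h : (fun p : K * K => p.1 * p.2) @ (w, w) --> w * w.
  by apply: cvgM; [exact: cf|exact: cs].
exact: (cvgV ww0 h).
Qed.

End RationalSlopes.

Section Shapes.
Variable R : realType.
Notation K := (Cplx R).

Definition shape_slope (q : 'I_3) (p : K * K) : K :=
  nth 0 [:: 1; ((1 - p.1) * (1 - p.2))^-1; (p.1 * p.2)^-1] q.

Lemma shape_scalar_slope (q : 'I_3) (b : K) : b != 0 -> b != 1 ->
  scalar_slope_at (@shape_param R q) (shape_slope q) b /\
  (\forall w \near b, {for w, continuous (@shape_param R q)}).
Proof.
move=> b0 b1; case: q => [[|[|[|//]]] ?].
- exact: (id_scalar_slope b).
- exact: (inv_onem_scalar_slope b1).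
- exact: (onem_inv_scalar_slope b0).
Qed.

(** Closed forms of the derivatives of log z, log z' and log z''. *)
Definition dlog_shape (q : 'I_3) (b : K) : K :=
  nth 0 [:: b^-1; (1 - b)^-1; (b * (b - 1))^-1] q.

Lemma shape_slopeE q (b : K) : b != 0 -> b != 1 ->
  shape_slope q (b, b) / shape_param q b = dlog_shape q b.
Proof.
move=> b0 b1; have s1 : 1 - b != 0 by rewrite subr_eq0 eq_sym.
have s2 : b - 1 != 0 by rewrite subr_eq0.
case: q => [[|[|[|//]]] ?]; rewrite /shape_param /shape_slope /dlog_shape /=.
- by rewrite mul1r.
- by field.
- by field; rewrite b0 s2.
Qed.

End Shapes.

Section LogarithmicSum.
Variables (R : realType) (n : nat).
Notation K := (Cplx R).
Variables (z : 'rV[K]_n) (L : 'I_3 -> 'I_n -> K -> K).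
Hypotheses (hz : shapes z) (hL : log_branches z L).

(** For [c] the matrices [glue_mx T al], this is F_al: the edge sums followed by the holonomies. *)
Definition logsum p (c : 'I_3 -> 'M[int]_(p, n)) (w : 'rV[K]_n) : 'rV[K]_p :=
  \row_j \sum_i \sum_(q < 3) (c q j i)%:~R * L q i (shape_param q (w 0 i)).

Definition log_slope q i (p : K * K) : K :=
  shape_slope q p /
  cexp_slope (L q i (shape_param q p.1), L q i (shape_param q p.2)).

(** Rows are indexed by tetrahedra and columns by equations, since matrices act on row vectors. Each
    logarithm depends on one coordinate, so scalar slopes suffice. *)
Definition logsum_slope p (c : 'I_3 -> 'M[int]_(p, n))
    (xy : 'rV[K]_n * 'rV[K]_n) : 'M[K]_(n, p) :=
  \matrix_(i, j)
    \sum_(q < 3) (c q j i)%:~R * log_slope q i (xy.1 0 i, xy.2 0 i).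

Lemma shapes_neq i : z 0 i != 0 /\ z 0 i != 1.
Proof. by split; apply/eqP; have [] := hz i. Qed.

Lemma log_slope_at q i :
  [/\ scalar_slope_at (L q i \o @shape_param R q) (log_slope q i) (z 0 i),
      \forall w \near z 0 i, cexp (L q i (shape_param q w)) = shape_param q w &
      log_slope q i (z 0 i, z 0 i) = dlog_shape q (z 0 i)].
Proof.
have [z0 z1] := shapes_neq i; have [sq sc] := shape_scalar_slope q z0 z1.
have [ls le _] := log_scalar_slope (hL q i) sq sc; split=> //.
rewrite /log_slope /= cexp_slope_diag (nbhs_singleton le).
exact: shape_slopeE.
Qed.

Lemma logsum_slope_at p (c : 'I_3 -> 'M[int]_(p, n)) :
  slope_at (logsum c) (logsum_slope c) z.
Proof.
split.
  have H i q : \forall xy \near (z, z),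
      L q i (shape_param q ((xy.1 : 'rV[K]_n) 0 i))
        - L q i (shape_param q ((xy.2 : 'rV[K]_n) 0 i)) =
      log_slope q i (xy.1 0 i, xy.2 0 i) * (xy.1 0 i - xy.2 0 i).
    have [[sl _] _ _] := log_slope_at q i.
    have h := @cvg_map_pair _ _ (fun M : 'rV[K]_n => M 0 i) z
      (@coord_continuous K 1 n 0 i z).
    exact: (cvg_near h sl).
  apply: filterS (near_forall2 H) => xy {}H; apply/rowP => j; rewrite !mxE.
  rewrite -sumrB; apply: eq_bigr => i _; rewrite !mxE -sumrB mulr_sumr.
  by apply: eq_bigr => q _; rewrite -mulrBr H mulrA mulrC.
have H i q : \forall w \near z,
    {for ((w : 'rV[K]_n) 0 i, w 0 i), continuous (log_slope q i)}.
  have [[_ sl] _ _] := log_slope_at q i.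
  exact: (cvg_near (@coord_continuous K 1 n 0 i z) sl).
apply: filterS (near_forall2 H) => w {}H.
have : logsum_slope c xy @[xy --> (w, w)] --> logsum_slope c (w, w); last by [].
apply: cvg_mx => i j; rewrite /logsum_slope mxE.
under eq_cvg do rewrite mxE.
apply: cvg_sumr => q _; apply: cvgM; first exact: cvg_cst.
have h := @cvg_map_pair _ _ (fun M : 'rV[K]_n => M 0 i) w
  (@coord_continuous K 1 n 0 i w).
exact: (cvg_comp _ _ h (H i q)).
Qed.

Lemma logsum_slope_diag p (c : 'I_3 -> 'M[int]_(p, n)) :
  logsum_slope c (z, z) =
  \matrix_(i, j) \sum_(q < 3) (c q j i)%:~R * dlog_shape q (z 0 i).
Proof.
apply/matrixP => i j; rewrite !mxE; apply: eq_bigr => q _.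
by have [_ _ ->] := log_slope_at q i.
Qed.

Lemma logsum_cvg p (c : 'I_3 -> 'M[int]_(p, n)) :
  logsum c w @[w --> z] --> logsum c z.
Proof.
have [sl /nbhs_singleton sc] := logsum_slope_at c.
exact: (differentiable_continuous (slope_differentiable sl sc)).
Qed.

Lemma near_cexp_log : \forall w \near z, forall i q,
  cexp (L q i (shape_param q ((w : 'rV[K]_n) 0 i))) = shape_param q (w 0 i).
Proof.
have H i q : \forall w \near z,
    cexp (L q i (shape_param q ((w : 'rV[K]_n) 0 i))) = shape_param q (w 0 i).
  have [_ sl _] := log_slope_at q i.
  exact: (cvg_near (@coord_continuous K 1 n 0 i z) sl).
exact: (near_forall2 H).
Qed.

Lemma near_shapes : \forall w \near z, shapes w.
Proof.
have H i : \forall w \near z, (w : 'rV[K]_n) 0 i != 0 /\ w 0 i != 1.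
  have [z0 z1] := shapes_neq i.
  have h : \forall x \near z 0 i, x != 0 /\ x != 1.
    by apply: filterI; exact: near_neq.
  exact: (cvg_near (@coord_continuous K 1 n 0 i z) h).
by apply: filterS (near_forall H) => w h i; have [/eqP ? /eqP ?] := h i.
Qed.

End LogarithmicSum.

(** * Coordinates on the gluing variety *)

Section Coordinates.
Variables (R : realType) (m k : nat).
Notation K := (Cplx R).
Notation E := 'rV[K]_(m + k).
Variables (F : E -> E) (Q : E * E -> 'M[K]_(m + k)) (z : E) (V : set E).
Hypotheses (FQ : slope_at F Q z) (Qu : Q (z, z) \in unitmx).
Hypothesis VF : \forall w \near z, V w <-> lsubmx (F w) = lsubmx (F z).

Let H (w : E) : 'rV[K]_k := rsubmx (F w).
Let g (h : 'rV[K]_k) : E := row_mx (lsubmx (F z)) h.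

Lemma row_mx_differentiable (h : 'rV[K]_k) : differentiable g h.
Proof.
pose P (_ : 'rV[K]_k * 'rV[K]_k) : 'M[K]_(k, m + k) := row_mx 0 1%:M.
apply: (@slope_differentiable _ _ _ g P); last exact: cvg_cst.
near=> xy; rewrite /g opp_row_mx add_row_mx subrr mul_mx_row mulmx0 mulmx1.
by [].
Unshelve. all: by end_near. Qed.

(** Near [z], [V] is the preimage under [F] of the slice parametrized by [g], where the first
    components are frozen; [zeta] is the local inverse of [F] restricted to this slice. *)
Lemma coordinate_inverse_exists : exists zeta, coordinate_inverse V H z zeta.
Proof.
have [Phi [PhiF PhiK]] := inverse_function FQ Qu.
have gz : g (H z) = F z by rewrite /g /H hsubmxK.
have Phiz : Phi (F z) = z by exact: nbhs_singleton PhiK.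
have gc : g h @[h --> H z] --> F z.
  rewrite -gz.
  exact: differentiable_continuous (row_mx_differentiable (H z)).
have [dPhi _] := nbhs_singleton PhiF.
have Phic : Phi y @[y --> F z] --> z.
  by rewrite -[X in _ --> X]Phiz; exact: differentiable_continuous dPhi.
exists (Phi \o g); split; first by rewrite /= gz.
  have n1 := cvg_near gc PhiF.
  have n2 := cvg_near (cvg_comp _ _ gc Phic) VF.
  apply: filterS2 n1 n2 => h [dh Fh] Vh; split.
  - exact: (differentiable_comp (row_mx_differentiable h) dh).
  - by apply/Vh; rewrite /= Fh row_mxKl.
  - by rewrite /H /= Fh row_mxKr.
apply: filterS2 PhiK VF => w Phiw Vw /Vw Fw.
by rewrite /= /g /H -Fw hsubmxK.
Qed.

(** On [V] the increment of [F] is [row_mx 0 (h - H z)]. Multiplying by the inverse slope of [F]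
    gives the increment of [zeta], and then by the slope of [F'] that of [F' \o zeta]; the slopes
    converge as [h] tends to [H z]. *)
Lemma coordinate_derive p (F' : E -> 'rV[K]_p) (Q' : E * E -> 'M[K]_(m + k, p))
    (zeta : 'rV[K]_k -> E) (i : 'I_p) (v : 'rV[K]_k) :
  slope_at F' Q' z -> coordinate_inverse V H z zeta ->
  'D_v ((fun w => F' w 0 i) \o zeta) (H z) =
  (row_mx 0 v *m invmx (Q (z, z)) *m Q' (z, z)) 0 i.
Proof.
move=> [F'z /nbhs_singleton Q'z] [zetaz zetaP _].
have [Fz /nbhs_singleton Qz] := FQ.
have [dzeta _ _] := nbhs_singleton zetaP.
have zc : zeta h @[h --> H z] --> z.
  by rewrite -[X in _ --> X]zetaz; exact: differentiable_continuous dzeta.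
have zzc : (zeta h, z) @[h --> H z] --> (z, z).
  exact: (cvg_prod_nbhs zc (cvg_cst z)).
have Qc := cvg_comp _ _ zzc Qz; have Q'c := cvg_comp _ _ zzc Q'z.
pose B : 'M[K]_(k, m + k) := row_mx 0 1%:M.
pose W h := B *m (invmx (Q (zeta h, z)) *m Q' (zeta h, z)).
have WA : W h @[h --> H z] --> B *m (invmx (Q (z, z)) *m Q' (z, z)).
  exact: (cvg_mulmx (cvg_cst B) (cvg_mulmx (cvg_invmx Qc Qu) Q'c)).
have vB (u : 'rV[K]_k) : u *m B = row_mx 0 u.
  by rewrite mul_mx_row mulmx0 mulmx1.
rewrite -mulmxA -vB -mulmxA; apply: slope_derive WA.
have nQ := cvg_unitmx Qc Qu.
have nV := cvg_near zc VF.
have nF := cvg_near zzc Fz.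
have nF' := cvg_near zzc F'z.
near=> h => /=; rewrite zetaz.
have /= Fh : F (zeta h, z).1 - F (zeta h, z).2 =
    ((zeta h, z).1 - (zeta h, z).2) *m Q (zeta h, z) by near: h; exact: nF.
have /= F'h : F' (zeta h, z).1 - F' (zeta h, z).2 =
    ((zeta h, z).1 - (zeta h, z).2) *m Q' (zeta h, z) by near: h; exact: nF'.
have Qh : Q (zeta h, z) \in unitmx by near: h; exact: nQ.
have Vh : V (zeta h) <-> lsubmx (F (zeta h)) = lsubmx (F z).
  by near: h; exact: nV.
have [_ Vz Hz] : [/\ differentiable zeta h, V (zeta h) & H (zeta h) = h].
  by near: h; exact: zetaP.
have E1 : F (zeta h) - F z = row_mx 0 (h - H z).
  rewrite -[F (zeta h)]hsubmxK -[F z in LHS]hsubmxK opp_row_mx add_row_mx.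
  by rewrite (Vh.1 Vz) subrr -/(H _) Hz.
by rewrite /W mulmxA vB -E1 Fh mulmxA mulmxK// -F'h !mxE.
Unshelve. all: by end_near. Qed.

End Coordinates.

(** * The invariant as a Jacobian determinant *)

Lemma sum_ord3 (V : nmodType) (F : 'I_3 -> V) : \sum_q F q = F 0 + F 1 + F 2.
Proof.
rewrite !big_ord_recl big_ord0 addr0 addrA.
by congr (F _ + F _ + F _); exact: val_inj.
Qed.

Section GluingVariety.
Variables (R : realType) (m k : nat) (T : ideal_triangulation m k).
Notation K := (Cplx R).
Variables (z : 'rV[K]_(m + k)) (L : 'I_3 -> 'I_(m + k) -> K -> K).
Hypotheses (hz : gluing_variety T z) (hL : log_branches z L).
Implicit Type al : 'I_k -> closed_curve R (m + k).

Let jac al := logsum_slope L (glue_mx T al) (z, z).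

Lemma log_holonomyE al :
  log_holonomy T L al = fun w => rsubmx (logsum L (glue_mx T al) w).
Proof.
apply/funext => w; apply/rowP => j; rewrite !mxE.
apply: eq_bigr => i _; apply: eq_bigr => q _.
by rewrite /glue_mx col_mxEd mxE.
Qed.

(** The edge rows of [glue_mx] do not involve the curves; the identity block in the final
    determinant comes from this. *)
Lemma lsubmx_logsum_slope al al' xy :
  lsubmx (logsum_slope L (glue_mx T al) xy) =
  lsubmx (logsum_slope L (glue_mx T al') xy).
Proof.
apply/matrixP => i j; rewrite !mxE; apply: eq_bigr => q _.
by rewrite /glue_mx !col_mxEu !mxE.
Qed.

Lemma near_edge_product al : \forall w \near z, forall j,
  cexp (logsum L (glue_mx T al) w 0 (lshift k j)) =
  edge_product T (lshift k j) w.
Proof.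
apply: filterS (near_cexp_log hz.1 hL) => w hw j.
rewrite mxE cexp_sum; apply: eq_bigr => i _.
rewrite cexp_sum; apply: eq_bigr => q _.
by rewrite /glue_mx col_mxEu mxE -pmulrn cexpMn hw.
Qed.

(** An edge sum at [z] is some logarithm of 1, depending on the branches, so the fibre is the one
    through [z] and not that of 0. Nearby, local injectivity of exp forces a sum whose exponential
    is 1 to keep its value at [z]. *)
Lemma gluing_variety_near al : \forall w \near z, gluing_variety T w <->
  lsubmx (logsum L (glue_mx T al) w) = lsubmx (logsum L (glue_mx T al) z).
Proof.
set F := logsum L (glue_mx T al).
have Finj j : \forall w \near z, cexp (F w 0 j) = cexp (F z 0 j) ->
    F w 0 j = F z 0 j.
  have h : F w 0 j @[w --> z] --> F z 0 j.
    have Fc : F w @[w --> z] --> F z.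
      exact: (logsum_cvg hz.1 hL).
    exact: (cvg_comp _ _ Fc (@coord_continuous K 1 (m + k) 0 j (F z))).
  exact: (cexp_locally_injective h).
have Fz j : cexp (F z 0 (lshift k j)) = 1.
  by rewrite (nbhs_singleton (near_edge_product al) j); exact: hz.2.
apply: filterS3 (near_forall Finj) (near_edge_product al) (near_shapes hz.1).
move=> w {}Finj Fw hw; split=> [[_ hV]|/rowP FE].
  apply/rowP => j; rewrite [LHS]mxE [RHS]mxE; apply: Finj.
  by rewrite Fz (Fw j); exact: hV.
split=> // j; rewrite -(Fw j) -[RHS](Fz j).
by have := FE j; rewrite [X in X = _]mxE [X in _ = X]mxE => ->.
Qed.

(* [(z - 1)] times the derivatives [1/z], [1/(1-z)] and [1/(z(z-1))] of the   *)
(* three logarithms are [z''], [-1] and [1/z]; but [-1 = - z'' - 1/z].        *)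
Lemma tau_jacobian al f :
  tau T al f z = \det (jac al) *
    (2^-1 * \prod_i (z 0 i - 1) *
     \prod_i (z 0 i ^ f 2 0 i * shape_param 2 (z 0 i) ^ (- f 0 0 i))).
Proof.
rewrite /tau; set G := fun q => intr_mx R (glue_mx T al q).
have z0 i : z 0 i != 0 by have [] := shapes_neq hz.1 i.
have z1 i : z 0 i - 1 != 0 by have [_] := shapes_neq hz.1 i; rewrite subr_eq0.
have zV : invmx (diag_mx z) = diag_mx (map_mx GRing.inv z).
  have zzV : diag_mx z *m diag_mx (map_mx GRing.inv z) = 1%:M.
    rewrite mulmx_diag -diag_const_mx; congr diag_mx; apply/rowP => i.
    by rewrite !mxE divff.
  by have [zu _] := mulmx1_unit zzV; rewrite -[RHS](mulKmx zu) zzV mulmx1.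
(* The transpose appears because the rows of [G] are indexed by equations and those of [jac] by
   tetrahedra. *)
have -> : (G 0 - G 1) *m diag_mx (map_mx (@shape_param R 2) z)
    + (G 2 - G 1) *m invmx (diag_mx z)
    = (jac al)^T *m diag_mx (\row_i (z 0 i - 1)).
  rewrite zV !mul_mx_diag /jac (logsum_slope_diag hz.1 hL) /G.
  move: (glue_mx T al) => c; apply/matrixP => j i; rewrite !mxE sum_ord3.
  rewrite /shape_param /dlog_shape /=.
  have z1' : 1 - z 0 i != 0 by rewrite -opprB oppr_eq0.
  by field; rewrite z0 z1 z1'.
rewrite det_mulmx det_tr det_diag.
have -> : \prod_i (\row_i (z 0 i - 1)) 0 i = \prod_i (z 0 i - 1).
  by apply: eq_bigr => i _; rewrite mxE.
by rewrite !mulrA; congr (_ * _ * _); rewrite mulrC.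
Qed.

End GluingVariety.

(** * Change of the system of curves *)

Theorem theorem1p19 (R : realType) (m k : nat)
    (M : hyperbolic_manifold R) (T : ideal_triangulation m k)
    (hT : triangulates T M) (hE : edges_ordered R T)
    (z : 'rV[Cplx R]_(m + k)) (hz : gluing_variety T z)
    (f : 'I_3 -> 'rV[int]_(m + k)) (hf : strong_flattening R T f)
    (L : 'I_3 -> 'I_(m + k) -> Cplx R -> Cplx R) (hL : log_branches z L)
    (al al' : 'I_k -> closed_curve R (m + k))
    (hal : curve_system T al) (hal' : curve_system T al')
    (htau : tau T al f z <> 0) :
  eq_up_to_sign (tau T al' f z)
    (\det (\matrix_(i, j)
        coordinate_partial (@gluing_variety R m k T) (log_holonomy T L al) z
          (fun w => log_holonomy T L al' w 0 i) j)
     * tau T al f z).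
Proof.
(* The factor common to both invariants cancels; an identity between determinants of Jacobians
   remains. *)
left; rewrite !(tau_jacobian hz hL) [RHS]mulrA; congr (_ * _).
set J := logsum_slope L (glue_mx T al) (z, z).
set J' := logsum_slope L (glue_mx T al') (z, z).
have Ju : J \in unitmx.
  rewrite unitmxE unitfE; apply/eqP => J0; apply: htau.
  by rewrite (tau_jacobian hz hL) -/J J0 mul0r.
have FQ := logsum_slope_at hz.1 hL (glue_mx T al).
have FQ' := logsum_slope_at hz.1 hL (glue_mx T al').
have VF := gluing_variety_near hz hL al.
have zetaP := getPex (coordinate_inverse_exists FQ Ju VF).
pose X := invmx J *m J'.
(* The first [m] columns of [J'] are those of [J], so [invmx J] sends them to the first columns of
   the identity. *)
have XE : X = block_mx 1%:M (usubmx (rsubmx X)) 0 (dsubmx (rsubmx X)).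
  have lX : lsubmx X = col_mx 1%:M 0.
    rewrite /X -[J']hsubmxK mul_mx_row row_mxKl.
    rewrite (@lsubmx_logsum_slope _ _ _ T L al' al).
    have : lsubmx (invmx J *m J) = col_mx 1%:M 0.
      by rewrite mulVmx// scalar_mx_block block_mxEh row_mxKl.
    by rewrite -{2}[J]hsubmxK mul_mx_row row_mxKl.
  by rewrite block_mxEh vsubmxK -lX hsubmxK.
have -> : \det J' = \det (dsubmx (rsubmx X)) * \det J.
  have -> : J' = J *m X by rewrite /X mulKVmx.
  by rewrite det_mulmx {1}XE det_ublock det1 mul1r mulrC.
(* The lower right block of [X] has its rows indexed by the coordinates H(al_j) and its columns by
   the functions H(al'_i), hence the transposition. *)
congr (_ * _); rewrite -det_tr; congr (\det _).
apply/matrixP => i j; rewrite [LHS]mxE [RHS]mxE /coordinate_partial.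
rewrite !log_holonomyE -[LHS]/(dsubmx (rsubmx X) j i).
have -> : (fun w => rsubmx (logsum L (glue_mx T al') w) 0 i) =
    (fun w => logsum L (glue_mx T al') w 0 (rshift m i)).
  by apply/funext => w; rewrite [LHS]mxE.
rewrite (coordinate_derive FQ Ju VF _ _ FQ' zetaP) -mulmxA -/J -/J' -/X.
(* The row vector made of 0 and the j-th basis vector selects row [j] of the lower blocks of [X]. *)
by rewrite {2}XE mul_row_block !mul0mx !add0r row_mxEr -rowE [RHS]mxE.
Qed.
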